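(* Let $q_1,q_2\in\mathbb{K}\setminus\{0,1\}$ and $\lambda\in\mathbb{K}^*$ be such that $q_i$ is a primitive $l_i$-th root of unity for $i=1,2$ and $\lambda$ is an $l_1$-th root of unity (i.e. $\lambda^{l_1}=1$). Then the PI-degree of the rank-two quantum Weyl algebra $A_2^{\underline{q},\Lambda}$ is $l_1l_2$.
   Context: $\mathbb{K}$ is an algebraically closed field of arbitrary characteristic. The quantum Weyl algebra $A_2^{\underline{q},\Lambda}$ of rank two, with $\underline q=(q_1,q_2)$ and $\Lambda=(\lambda_{ij})$ the $2\times2$ multiplicatively antisymmetric matrix with $\lambda_{11}=\lambda_{22}=1$, $\lambda_{12}=\lambda$, $\lambda_{21}=\lambda^{-1}$, is the unital associative $\mathbb{K}$-algebra generated by $x_1,y_1,x_2,y_2$ subject to $$x_1x_2=q_1\lambda x_2x_1,\quad x_1y_2=\lambda^{-1}y_2x_1,\quad y_1y_2=\lambda y_2y_1,\quad y_1x_2=q_1^{-1}\lambda^{-1}x_2y_1,$$ $$x_1y_1-q_1y_1x_1=1,\qquad x_2y_2-q_2y_2x_2=1+(q_1-1)y_1x_1.$$ It is a noetherian domain, and in the present root-of-unity setting it is a prime polynomial identity (PI) algebra. The PI-degree of a prime PI algebra is half the minimal degree of a (multilinear, monic) polynomial identity it satisfies; equivalently, the square root of the dimension of its total ring of fractions over the center of that ring. *)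

(* Defs.v *)
From HB Require Import structures.
From mathcomp Require Import all_boot all_order all_algebra all_fingroup.
From mathcomp Require Import generic_quotient ring_quotient boolp.
From mathcomp Require Import monalg.

Set Implicit Arguments.
Unset Strict Implicit.
Unset Printing Implicit Defensive.

Import GRing.Theory.
Local Open Scope ring_scope.
Local Open Scope quotient_scope.

(* The monoid algebra of the free monoid on X, i.e. K<X>. *)
Notation free_alg K X := {malg K[{fmonom X}]}.

Definition free_gen (K : nzRingType) (X : choiceType) (i : X) : free_alg K X :=
  << fmu i >>.

Section Presented.
Variables (K : comNzRingType) (X : choiceType).
Local Notation F := (free_alg K X).
Variable rels : seq F.

Definition in_ideal_gen (f : F) : Prop :=
  exists2 s : seq (F * F * F),
    all (fun t => t.1.2 \in rels) s & f = \sum_(t <- s) t.1.1 * t.1.2 * t.2.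

Definition ideal_gen (f : F) : bool := `[< in_ideal_gen f >].

Lemma ideal_genP f : reflect (in_ideal_gen f) (f \in ideal_gen).
Proof. exact: asboolP. Qed.

Lemma ideal_gen_zmod : zmod_closed ideal_gen.
Proof.
split; first by apply/ideal_genP; exists [::]; rewrite ?big_nil.
move=> f g /ideal_genP[s hs ->] /ideal_genP[t ht ->]; apply/ideal_genP.
exists (s ++ [seq (- u.1.1, u.1.2, u.2) | u <- t]).
  rewrite all_cat hs all_map; apply: sub_all ht => u; exact: id.
rewrite big_cat big_map /= -sumrN; congr (_ + _).
by apply: eq_bigr => u _; rewrite !mulNr.
Qed.

HB.instance Definition _ := GRing.isZmodClosed.Build F ideal_gen ideal_gen_zmod.

Lemma ideal_genMl a f : f \in ideal_gen -> a * f \in ideal_gen.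
Proof.
move=> /ideal_genP[s hs ->]; apply/ideal_genP.
exists [seq (a * u.1.1, u.1.2, u.2) | u <- s].
  rewrite all_map; apply: sub_all hs => u; exact: id.
by rewrite big_map mulr_sumr; apply: eq_bigr => u _ /=; rewrite !mulrA.
Qed.

Lemma ideal_genMr a f : f \in ideal_gen -> f * a \in ideal_gen.
Proof.
move=> /ideal_genP[s hs ->]; apply/ideal_genP.
exists [seq (u.1.1, u.1.2, u.2 * a) | u <- s].
  rewrite all_map; apply: sub_all hs => u; exact: id.
rewrite big_map big_distrl /=; apply: eq_bigr => u _.
exact/esym/mulrA.
Qed.

Lemma ideal_genZ c f : f \in ideal_gen -> c *: f \in ideal_gen.
Proof. by move=> hf; rewrite -mul_malgC; apply: ideal_genMl. Qed.

Local Notation I := (GRing.ZmodClosed.clone F ideal_gen _).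

(* K<X> / (rels). It may be the zero ring, so in general it only gets pzRingType
   and lmodType structures: in MathComp, an algType is nonzero. *)
Definition presented : Type := Quotient.quot I.

HB.instance Definition _ := Choice.on presented.
HB.instance Definition _ := GRing.Zmodule.on presented.
HB.instance Definition _ : EqQuotient F (Quotient.equiv I) presented :=
  EqQuotient.on presented.
HB.instance Definition _ :
  ZmodQuotient F (Quotient.equiv I) 0 -%R +%R presented :=
  ZmodQuotient.on presented.

Lemma pi_presentedP (f g : F) :
  reflect (\pi_presented f = \pi_presented g) (f - g \in ideal_gen).
Proof. by rewrite Quotient.idealrBE; exact: eqP. Qed.

Lemma repr_presented (f : F) : repr (\pi_presented f) - f \in ideal_gen.
Proof. by apply/pi_presentedP; rewrite reprK. Qed.

Definition presented_one : presented := \pi_presented 1.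
Definition presented_mul (u v : presented) : presented :=
  \pi_presented (repr u * repr v).
Definition presented_scale (c : K) (u : presented) : presented :=
  \pi_presented (c *: repr u).

Lemma pi_presentedM (f g : F) :
  \pi_presented (f * g) = presented_mul (\pi f) (\pi g).
Proof.
apply/esym/pi_presentedP.
set f' := repr _; set g' := repr _.
have -> : f' * g' - f * g = f' * (g' - g) + (f' - f) * g.
  by rewrite mulrBr mulrBl addrA subrK.
by apply: rpredD; [apply: ideal_genMl | apply: ideal_genMr];
  apply: repr_presented.
Qed.

Lemma pi_presentedZ c (f : F) :
  \pi_presented (c *: f) = presented_scale c (\pi f).
Proof.
apply/esym/pi_presentedP; rewrite -scalerBr.
by apply: ideal_genZ; apply: repr_presented.
Qed.

Lemma pi_presentedD (f g : F) :
  \pi_presented (f + g) = \pi f + \pi g.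
Proof. exact: pi_addr. Qed.

Lemma presentedE (u : presented) : exists f, u = \pi_presented f.
Proof. by exists (repr u); rewrite reprK. Qed.

Lemma presented_mulA : associative presented_mul.
Proof.
move=> u v w; have [f ->] := presentedE u; have [g ->] := presentedE v.
have [k ->] := presentedE w.
rewrite -(pi_presentedM g k) -(pi_presentedM f g) -(pi_presentedM f).
by rewrite -(pi_presentedM (f * g)) mulrA.
Qed.

Lemma presented_mul1 : left_id presented_one presented_mul.
Proof.
by move=> u; have [f ->] := presentedE u; rewrite -(pi_presentedM 1 f) mul1r.
Qed.

Lemma presented_mulr1 : right_id presented_one presented_mul.
Proof.
by move=> u; have [f ->] := presentedE u; rewrite -(pi_presentedM f 1) mulr1.
Qed.

Lemma presented_mulDl : left_distributive presented_mul +%R.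
Proof.
move=> u v w; have [f ->] := presentedE u; have [g ->] := presentedE v.
have [k ->] := presentedE w.
rewrite -(pi_presentedM f k) -(pi_presentedM g k) -(pi_presentedD f g).
by rewrite -(pi_presentedD (f * k)) -(pi_presentedM (f + g)) mulrDl.
Qed.

Lemma presented_mulDr : right_distributive presented_mul +%R.
Proof.
move=> u v w; have [f ->] := presentedE u; have [g ->] := presentedE v.
have [k ->] := presentedE w.
rewrite -(pi_presentedM f g) -(pi_presentedM f k) -(pi_presentedD g k).
by rewrite -(pi_presentedD (f * g)) -(pi_presentedM f) mulrDr.
Qed.

HB.instance Definition _ := GRing.Zmodule_isPzRing.Build presented
  presented_mulA presented_mul1 presented_mulr1 presented_mulDl presented_mulDr.

Lemma presented_scaleA a b u :
  presented_scale a (presented_scale b u) = presented_scale (a * b) u.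
Proof.
have [f ->] := presentedE u.
by rewrite -(pi_presentedZ b f) -(pi_presentedZ a) -(pi_presentedZ _ f) scalerA.
Qed.

Lemma presented_scale1 : left_id 1 presented_scale.
Proof.
by move=> u; have [f ->] := presentedE u; rewrite -(pi_presentedZ 1 f) scale1r.
Qed.

Lemma presented_scaleDr : right_distributive presented_scale +%R.
Proof.
move=> c u v; have [f ->] := presentedE u; have [g ->] := presentedE v.
rewrite -(pi_presentedZ c f) -(pi_presentedZ c g) -(pi_presentedD f g).
by rewrite -(pi_presentedD (c *: f)) -(pi_presentedZ c (f + g)) scalerDr.
Qed.

Lemma presented_scaleDl u : {morph presented_scale^~ u : a b / a + b}.
Proof.
have [f ->] := presentedE u; move=> a b.
rewrite -(pi_presentedZ a f) -(pi_presentedZ b f) -(pi_presentedZ (a + b) f).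
by rewrite -(pi_presentedD (a *: f)) scalerDl.
Qed.

HB.instance Definition _ := GRing.Zmodule_isLmodule.Build K presented
  presented_scaleA presented_scale1 presented_scaleDr presented_scaleDl.

Lemma presented_scaleAl (c : K) (u v : presented) : c *: (u * v) = c *: u * v.
Proof.
have [f ->] := presentedE u; have [g ->] := presentedE v.
change (presented_scale c (presented_mul (\pi f) (\pi g)) =
        presented_mul (presented_scale c (\pi f)) (\pi g)).
rewrite -(pi_presentedM f g) -(pi_presentedZ c f) -(pi_presentedZ c).
by rewrite -(pi_presentedM (c *: f)) -scalerAl.
Qed.

Lemma free_algMC (f : F) (c : K) : f * c%:MP = c *: f.
Proof.
rewrite malgM_def fgmulgU malgZ_def.
by apply: eq_bigr => m _; rewrite mulm1 mulrC.
Qed.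

Lemma presented_scaleAr (c : K) (u v : presented) : c *: (u * v) = u * (c *: v).
Proof.
have [f ->] := presentedE u; have [g ->] := presentedE v.
change (presented_scale c (presented_mul (\pi f) (\pi g)) =
        presented_mul (\pi f) (presented_scale c (\pi g))).
rewrite -(pi_presentedM f g) -(pi_presentedZ c g) -(pi_presentedZ c).
by rewrite -(pi_presentedM f) -!free_algMC mulrA.
Qed.

End Presented.

Section QuantumWeyl2.
Variable K : fieldType.
Local Notation F := (free_alg K 'I_4).

Definition Wx1 : F := free_gen K (@inord 3 0).
Definition Wy1 : F := free_gen K (@inord 3 1).
Definition Wx2 : F := free_gen K (@inord 3 2).
Definition Wy2 : F := free_gen K (@inord 3 3).

Definition qweyl2_rels (q1 q2 lam : K) : seq F :=
  [:: Wx1 * Wx2 - (q1 * lam) *: (Wx2 * Wx1);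
      Wx1 * Wy2 - lam^-1 *: (Wy2 * Wx1);
      Wy1 * Wy2 - lam *: (Wy2 * Wy1);
      Wy1 * Wx2 - (q1^-1 * lam^-1) *: (Wx2 * Wy1);
      Wx1 * Wy1 - q1 *: (Wy1 * Wx1) - 1;
      Wx2 * Wy2 - q2 *: (Wy2 * Wx2) - (1 + (q1 - 1) *: (Wy1 * Wx1))].

Section Nontrivial.
Variables (q1 q2 lam : K).
Hypothesis q1_neq1 : q1 != 1.

(* The character x1 |-> 1, y1 |-> (1 - q1)^-1, x2, y2 |-> 0. *)
Let v (i : 'I_4) : K := [:: 1; (1 - q1)^-1; 0; 0]`_i.
Let h (m : {fmonom 'I_4}) : K := \prod_(i <- (m : seq 'I_4)) v i.

Let h_morph : mmorphism h.
Proof.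
split=> [m1 m2|]; rewrite /h; last by rewrite fm1 big_nil.
by rewrite fmM big_cat.
Qed.

HB.instance Definition _ := isMultiplicative.Build _ _ h h_morph.

Let ev : F -> K := mmap idfun h.

Let ev_gen (i : 'I_4) : ev (free_gen K i) = v i.
Proof. by rewrite /ev mmapU /= mul1r /h fmuE /= big_seq1. Qed.

Let evZ c f : ev (c *: f) = c * ev f.
Proof. by rewrite /ev mmapZ. Qed.

Let evB : {morph ev : f g / f - g}. Proof. exact: mmapB. Qed.
Let evD : {morph ev : f g / f + g}. Proof. exact: mmapD. Qed.
Let evM : {morph ev : f g / f * g}.
Proof. by have [+ _] := @mmap_is_multiplicative _ _ _ idfun h. Qed.
Let ev0 : ev 0 = 0. Proof. exact: raddf0. Qed.
Let ev1 : ev 1 = 1. Proof. exact: mmap1. Qed.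

Let evR f g c f' g' :
  ev (f * g - c *: (g' * f')) = ev f * ev g - c * (ev g' * ev f').
Proof. by rewrite evB evM evZ evM. Qed.

Let ev_rels r : r \in qweyl2_rels q1 q2 lam -> ev r = 0.
Proof.
have ex1 : ev Wx1 = 1 by rewrite /Wx1 ev_gen /v inordK.
have ey1 : ev Wy1 = (1 - q1)^-1 by rewrite /Wy1 ev_gen /v inordK.
have ex2 : ev Wx2 = 0 by rewrite /Wx2 ev_gen /v inordK.
have ey2 : ev Wy2 = 0 by rewrite /Wy2 ev_gen /v inordK.
have nz : 1 - q1 != 0 by rewrite subr_eq0 eq_sym.
rewrite !inE => /or4P[/eqP->|/eqP->|/eqP->|/or3P[] /eqP->].
- by rewrite evR ex1 ex2 mulr0 mul0r mulr0 subrr.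
- by rewrite evR ex1 ey2 mulr0 mul0r mulr0 subrr.
- by rewrite evR ey1 ey2 mulr0 mul0r mulr0 subrr.
- by rewrite evR ey1 ex2 mulr0 mul0r mulr0 subrr.
- rewrite evB evR ex1 ey1 ev1 mul1r mulr1 -{1}[_^-1]mul1r -mulrBl.
  by rewrite divff ?subrr.
- rewrite evB evR evD evZ evM ex1 ey1 ex2 ey2 ev1 mulr0 mulr0 mulr1.
  by rewrite -[q1 - 1]opprB mulNr divff // !subrr.
Qed.

Lemma qweyl2_neq0 : (1 : presented (qweyl2_rels q1 q2 lam)) != 0.
Proof.
apply/eqP => e.
have : (1 : F) - 0 \in ideal_gen (qweyl2_rels q1 q2 lam).
  by apply/pi_presentedP; rewrite -[LHS]/(1 : presented _) e pi_zeror.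
rewrite subr0 => /ideal_genP[s hs] /(congr1 ev).
rewrite ev1 (big_morph ev evD ev0) big_seq big1 => [/eqP|t ts].
  by rewrite oner_eq0.
by rewrite !evM (ev_rels (allP hs t ts)) mulr0 mul0r.
Qed.

End Nontrivial.

(* The proof argument only serves to endow the quotient with an algType
   structure, which requires 1 != 0. *)
Definition qweyl2 (q1 q2 lam : K) (q1_neq1 : q1 != 1) : Type :=
  presented (qweyl2_rels q1 q2 lam).

Section Instances.
Variables (q1 q2 lam : K) (q1_neq1 : q1 != 1).
Local Notation A := (qweyl2 q2 lam q1_neq1).

HB.instance Definition _ := GRing.PzRing.on A.
HB.instance Definition _ := GRing.Lmodule.on A.
HB.instance Definition _ :=
  GRing.PzSemiRing_isNonZero.Build A (qweyl2_neq0 q2 lam q1_neq1).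
HB.instance Definition _ :=
  GRing.Lmodule_isLalgebra.Build K A (@presented_scaleAl _ _ _).
HB.instance Definition _ :=
  GRing.Lalgebra_isAlgebra.Build K A (@presented_scaleAr _ _ _).
End Instances.

End QuantumWeyl2.

Arguments qweyl2 {K} q1 q2 lam q1_neq1.

Section PIdegree.
Variables (K : fieldType) (A : algType K).

(* c is the multilinear polynomial
     \sum_(s : 'S_d) c s *: X_(s 0) * ... * X_(s (d - 1)),
   whose monomials all have degree d; it is monic when some monomial has
   coefficient 1. *)
Definition multilinear_monic (d : nat) (c : 'S_d -> K) : Prop :=
  exists s, c s = 1.

Definition multilinear_identity (d : nat) (c : 'S_d -> K) : Prop :=
  forall a : 'I_d -> A, \sum_(s : 'S_d) c s *: \prod_(i < d) a (s i) = 0.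

Definition has_PI_of_degree (d : nat) : Prop :=
  exists2 c : 'S_d -> K, multilinear_monic c & multilinear_identity c.

(* The minimal degree of a polynomial identity of A is 2 * n. *)
Definition PI_degree (n : nat) : Prop :=
  has_PI_of_degree n.*2 /\ forall d, has_PI_of_degree d -> (n.*2 <= d)%N.

End PIdegree.

(* Main.v *)
From HB Require Import structures.
Require Import Defs.
From mathcomp Require Import all_boot all_order all_algebra all_fingroup.
From mathcomp Require Import generic_quotient boolp monalg mxtens zify ring.
Set Implicit Arguments.
Unset Strict Implicit.
Unset Printing Implicit Defensive.
Import GRing.Theory.
Local Open Scope ring_scope.
Local Open Scope quotient_scope.

(* The relation x y - q y x = 1 is realised by weighted cyclic shifts X, Y of
   size l, the order of q, depending on two nonzero parameters.  Twisting the
   second pair of generators by diagonal matrices acting on the first tensor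
   factor gives a family of representations of the quantum Weyl algebra by
   matrices of size l1 l2.

   Upper bound: the ordered monomials y1^a x1^b y2^c x2^d span the algebra, and
   the monomials Y^c X^d are linearly independent over the parameters (compare
   the top coefficients in one parameter, then the coefficients in the other),
   so the family is jointly faithful and the Amitsur-Levitzki identity of
   degree 2 l1 l2 holds.  That identity is proved following Rosset: over a
   Grassmann ring the square of X = sum e_i A_i has commuting entries and
   powers of zero trace, hence is nilpotent.  It is proved over the integers
   and transferred to any commutative ring by multilinearity.  Only the
   coefficient of the identity permutation, equal to 1, is needed, so the signs
   of the other ones are never computed.

   Lower bound: a single representation of the family is onto the matrices of
   size l1 l2, and these satisfy no monic multilinear identity of smaller
   degree, as seen on the staircase E_00, E_01, E_11, E_12, ... *)

(** * The Amitsur-Levitzki identity *)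

(** Stands in for characteristic zero: the Grassmann rings below contain no field, and Newton's
    identities only call for cancelling positive integers. *)
Definition torsion_free (V : nmodType) :=
  forall (x : V) (k : nat), x *+ k.+1 = 0 -> x = 0.

Lemma deriv_bigprod (R : comNzRingType) (I : finType) (F : I -> {poly R}) :
  (\prod_i F i)^`() = \sum_i (F i)^`() * \prod_(k | i != k) F k.
Proof.
have H (r : seq I) : uniq r -> (\prod_(i <- r) F i)^`() =
    \sum_(i <- r) (F i)^`() * \prod_(k <- r | i != k) F k.
  elim: r => [|x r IH] /=; first by rewrite !big_nil derivC.
  case/andP=> xr ur; rewrite !big_cons eqxx derivM IH //=; congr (_ * _ + _).
    rewrite [RHS]big_seq_cond [LHS]big_seq; apply: eq_bigl => k.
    by case: eqP => [<-|]; rewrite ?andbT // (negbTE xr).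
  rewrite mulr_sumr; apply: eq_big_seq => i ir; rewrite big_cons.
  by case: eqP ir xr => [->->//|_ _ _]; rewrite mulrCA.
exact/H/index_enum_uniq.
Qed.

(** * Newton's identities over a torsion-free commutative ring *)

Section Newton.
Variables (E : comNzRingType) (n : nat) (B : 'M[E]_n.+1).

(** Jacobi's formula for the derivative of a determinant. Only the diagonal entries of X - B depend
    on X, so differentiating a permutation term at row i leaves either a term of the cofactor (i, i)
    or zero. *)
Lemma deriv_char_poly :
  (char_poly B)^`() = \tr (\adj (char_poly_mx B)).
Proof.
rewrite /char_poly /determinant raddf_sum /= /mxtrace.
under [RHS]eq_bigr => i _ do rewrite mxE expand_cofactor.
rewrite [RHS](exchange_big_dep xpredT) //=; apply: eq_bigr => s _.
have dsgn (p : {poly E}) : ((-1) ^+ s * p)^`() = (-1) ^+ s * p^`().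
  by case: (s : bool); rewrite ?expr1 ?mulN1r ?derivN // expr0 !mul1r.
rewrite dsgn deriv_bigprod -mulr_sumr; congr (_ * _).
rewrite [LHS](bigID (fun i => s i == i)) /= [X in _ + X]big1 ?addr0.
  apply: eq_bigr => i /eqP si.
  by rewrite !mxE si eqxx mulr1n derivB derivX derivC subr0 mul1r.
move=> i /negbTE si; rewrite !mxE eq_sym si mulr0n sub0r derivN derivC.
by rewrite oppr0 mul0r.
Qed.

Hypothesis tfE : torsion_free E.
Hypothesis trB : forall k, (0 < k)%N -> \tr (B ^+ k) = 0.

Let D k : 'M[E]_n.+1 := \matrix_(i, j) (\adj (char_poly_mx B) i j)`_k.

(** Coefficient of degree k + 1 in adj(X - B) (X - B) = p, where p is the characteristic
    polynomial. *)
Let DS k : D k = ((char_poly B)`_k.+1)%:M + D k.+1 *m B.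
Proof.
have := mul_adj_mx (char_poly_mx B).
rewrite {2}/char_poly_mx mulmxBr mul_mx_scalar => /matrixP e.
apply/matrixP => i j; have /(congr1 (fun p : {poly E} => p`_k.+1)) := e i j.
rewrite !mxE coefB mulrC coefMX /= coefMn => /esym/eqP;
  rewrite eq_sym subr_eq => /eqP ->.
congr (_ + _); rewrite coef_sum; apply: eq_bigr => l _.
by rewrite !mxE coefMC.
Qed.

Let D_eq0 : exists m, forall k, (m <= k)%N -> D k = 0.
Proof.
exists (\max_(p : 'I_n.+1 * 'I_n.+1) size (\adj (char_poly_mx B) p.1 p.2)).
move=> k hk; apply/matrixP => i j; rewrite mxE [RHS]mxE nth_default //.
exact: leq_trans (leq_bigmax (i, j)) hk.
Qed.

(** Downward induction on k from the range where [D k] vanishes: [DS] replaces [D k] times B^i by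
    [D k.+1] times B^(i+1), up to a multiple of B^i, which has trace zero. *)
Let trDB k i : (0 < i)%N -> \tr (D k *m B ^+ i) = 0.
Proof.
have [m hm] := D_eq0; move: {-1}(m - k)%N (leqnn (m - k)) => d.
elim: d k i => [|d IH] k i hk i0.
  by rewrite hm ?mul0mx ?raddf0 // -subn_eq0 -leqn0.
rewrite DS mulmxDl raddfD /= mul_scalar_mx mxtraceZ trB // mulr0 add0r.
rewrite -mulmxA -[B *m _]/(B * B ^+ i) -exprS; apply: IH => //.
by rewrite subnS; case: (m - k)%N hk.
Qed.

(* Newton's identities, read off from [p' = tr (adj (X - B))]. *)
Lemma nilpotent_of_trace_eq0 : B ^+ n.+1 = 0.
Proof.
have trD k : \tr (D k) = (char_poly B)`_k.+1 *+ n.+1.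
  rewrite DS raddfD /= mxtrace_scalar; have := @trDB k.+1 1 isT.
  by rewrite expr1 => ->; rewrite addr0.
(* The trace of [D k] is (n + 1) p_(k+1) by [trD] and (k + 1) p_(k+1) as a coefficient of p', so (n
   - k) p_(k+1) = 0. The case k = n is the leading coefficient. *)
have pS k : k != n -> (char_poly B)`_k.+1 = 0.
  move=> kn; have := trD k.
  rewrite (_ : \tr (D k) = (char_poly B)^`()`_k); last first.
    by rewrite deriv_char_poly /mxtrace coef_sum; apply: eq_bigr => i _;
      rewrite mxE.
  rewrite coef_deriv => e.
  have [lt|lt|/eqP] := ltngtP k n; last by rewrite (negbTE kn).
    apply: (@tfE _ (n - k).-1); rewrite prednK ?subn_gt0 //.
    have -> : (n - k = n.+1 - k.+1)%N by [].
    by rewrite mulrnBr ?ltnS 1?ltnW // e subrr.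
  by rewrite nth_default // size_char_poly ltnS.
have /eqP ltr := char_poly_monic B.
(* Only the extreme terms of p survive in Cayley-Hamilton; the trace of this relation then gives (n
   + 1) p_0 = 0. *)
have CH : B ^+ n.+1 + ((char_poly B)`_0)%:M = 0.
  rewrite -[RHS](Cayley_Hamilton B) -[X in horner_mx B X]coefK poly_def
    rmorph_sum /=.
  rewrite size_char_poly big_ord_recl big_ord_recr /= [RHS]addrC; congr (_ + _).
    rewrite big1 ?add0r => [|i _]; last first.
      by rewrite pS ?scale0r ?rmorph0 // neq_ltn ltn_ord.
    rewrite linearZ rmorphXn /= horner_mx_X.
    by move: ltr; rewrite /lead_coef size_char_poly /= => ->; rewrite scale1r.
  by rewrite expr0 alg_polyC horner_mx_C.
have p0 : (char_poly B)`_0 = 0.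
  apply: (@tfE _ n); move/(congr1 mxtrace): CH.
  by rewrite raddfD /= trB // add0r mxtrace_scalar raddf0.
by rewrite p0 raddf0 addr0 in CH.
Qed.
End Newton.

(** * Grassmann rings and their commutative even part *)

Section MatrixEntry.
Variables (R : nmodType) (m n : nat) (i : 'I_m) (j : 'I_n).

Definition mxentry (A : 'M[R]_(m, n)) : R := A i j.

Lemma mxentry_is_nmod_morphism : nmod_morphism mxentry.
Proof. by split=> [|A B]; rewrite /mxentry mxE. Qed.

HB.instance Definition _ :=
  GRing.isNmodMorphism.Build 'M[R]_(m, n) R mxentry mxentry_is_nmod_morphism.
End MatrixEntry.

(* The inductive step represents the Grassmann algebra on one more generator
   by 2 x 2 matrices, the old generators acting as diag(e_i, - e_i). *)
Lemma grassmann_ring (m : nat) :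
  exists (R : nzRingType) (e : nat -> R) (phi : {additive R -> int}),
    [/\ torsion_free R, forall i, e i * e i = 0,
        forall i j, e i * e j = - (e j * e i) & phi (\prod_(i < m) e i) = 1].
Proof.
elim: m => [|m [R [e [phi [tfR ee eC phi1]]]]].
  exists int, (fun=> 0), idfun; split=> [x k /eqP|i|i j|].
  - by rewrite Num.Theory.mulrn_eq0 /= => /eqP.
  - by rewrite mul0r.
  - by rewrite mul0r oppr0.
  - by rewrite big_ord0.
pose D (x : R) : 'M[R]_2 :=
  \matrix_(i, j) (if i == j then (if i == 0 then x else - x) else 0).
pose e' i : 'M[R]_2 := if i is i'.+1 then D (e i') else delta_mx 1 0.
have DM x y : D x * D y = \matrix_(i, j) (if i == j then x * y else 0).
  apply/matrixP => i j; rewrite !mxE !big_ord_recl big_ord0 !mxE addr0.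
  by move: i j => [[|[|//]] ?] [[|[|//]] ?];
    rewrite //= ?mul0r ?mulr0 ?mulrNN ?addr0 ?add0r.
have Dd x : D x * delta_mx 1 0 = - (delta_mx 1 0 * D x).
  apply/matrixP => i j; rewrite !mxE !big_ord_recl !big_ord0 !mxE !addr0.
  by move: i j => [[|[|//]] ?] [[|[|//]] ?];
    rewrite //= ?mulr0n ?mulr1n ?mul0r ?mulr0 ?mulr1 ?mul1r ?addr0 ?add0r ?oppr0.
(* [phi] reads off the coefficient of the product of all generators. The new product starts with the
   matrix unit (1, 0), so its entry (1, 0) is the entry (0, 0) of the product of the [D (e i)], that
   is, the old product. *)
exists ('M[R]_2 : nzRingType), e', (phi \o @mxentry R 2 2 1 0); split.
- move=> x k /matrixP xk; apply/matrixP => i j; rewrite mxE.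
  by apply: (@tfR _ k); have := xk i j; rewrite mulmxnE mxE.
- case=> [|i] /=; first by rewrite [LHS]mul_delta_mx_0.
  by rewrite DM ee; apply/matrixP => k l; rewrite !mxE if_same.
- case=> [|i] [|j] /=; rewrite ?Dd ?opprK //.
  + by rewrite [X in - X]mul_delta_mx_0 // oppr0 [LHS]mul_delta_mx_0.
  + rewrite !DM eC; apply/matrixP => k l; rewrite !mxE.
    by case: eqP; rewrite ?oppr0.
have prodD (s : seq nat) : (\prod_(i <- s) D (e i)) 0 0 = \prod_(i <- s) e i.
  elim: s => [|i s IH]; first by rewrite !big_nil mxE.
  rewrite !big_cons -IH mxE !big_ord_recl big_ord0 !mxE /=.
  by rewrite mul0r !addr0.
rewrite big_ord_recl /= /mxentry mxE !big_ord_recl big_ord0 !mxE /= mul0r add0r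
  addr0 mul1r.
by rewrite -[RHS]phi1 -(big_mkord xpredT e) -prodD big_mkord; congr (phi _).
Qed.

Section Even.
Variables (R : nzRingType) (e : nat -> R).

(** Integer combinations of words in the generators whose length has parity b. No direct sum
    decomposition is claimed; words grow by one generator on the left, which makes the sign rule an
    induction. *)
Inductive graded : bool -> R -> Prop :=
| graded0 b : graded b 0
| graded1 : graded false 1
| gradedMe i b x : graded b x -> graded (~~ b) (e i * x)
| gradedD b x y : graded b x -> graded b y -> graded b (x + y)
| gradedN b x : graded b x -> graded b (- x).

Lemma gradedM b c x y : graded b x -> graded c y -> graded (b (+) c) (x * y).
Proof.
move=> hx hy; elim: {b x} hx => [b||i b x _ IH|b x x' _ IH _ IH'|b x _ IH].
- by rewrite mul0r; exact: graded0.
- by rewrite mul1r.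
- by rewrite -mulrA addNb; exact: gradedMe.
- by rewrite mulrDl; exact: gradedD.
- by rewrite mulNr; exact: gradedN.
Qed.

Lemma graded_sum b I (r : seq I) (P : pred I) F :
  (forall i, P i -> graded b (F i)) -> graded b (\sum_(i <- r | P i) F i).
Proof. by move=> h; elim/big_ind: _ => //; [exact: graded0|exact: gradedD]. Qed.

Lemma gradedZ b x z : graded b x -> graded b (x *~ z).
Proof.
have Mn k y : graded b y -> graded b (y *+ k).
  move=> h; elim: k => [|k IH]; first exact: graded0.
  by rewrite mulrS; exact: gradedD.
by case: z => k hx; [exact: Mn|rewrite NegzE mulrNz; apply/gradedN/Mn].
Qed.

Lemma graded_gen i : graded true (e i).
Proof. by rewrite -[e i]mulr1; apply: (@gradedMe _ false); exact: graded1. Qed.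

Hypothesis eC : forall i j, e i * e j = - (e j * e i).

(** Each crossing of two generators costs a sign; [eG] moves one generator past an element of known
    parity, and induction on x moves a whole word. *)
Lemma graded_comm b c x y :
  graded b x -> graded c y -> x * y = (-1) ^+ (b && c) * (y * x).
Proof.
have sgnC (d : bool) (u v : R) : u * ((-1) ^+ d * v) = (-1) ^+ d * (u * v).
  by rewrite mulrA commr_sign mulrA.
have eG i d z : graded d z -> e i * z = (-1) ^+ d * (z * e i).
  elim=> {d z} [d||j d z _ IH|d z z' _ IH _ IH'|d z _ IH].
  - by rewrite mul0r !mulr0.
  - by rewrite mul1r mulr1 mul1r.
  - by rewrite (mulrA (e i)) (eC i j) mulNr -(mulrA (e j) (e i)) IH (sgnC d)
      signrN mulNr !mulrA.
  - by rewrite mulrDr IH IH' mulrDl mulrDr.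
  - by rewrite mulrN IH mulNr mulrN.
move=> hx hy; elim: {b x} hx => [b||i b x _ IH|b x x' _ IH _ IH'|b x _ IH].
- by rewrite mul0r !mulr0.
- by rewrite mul1r mulr1 mul1r.
- rewrite -mulrA IH sgnC (mulrA (e i)) (eG _ _ _ hy) -(mulrA _ _ x) -(mulrA y).
  by rewrite [LHS]mulrA -signr_addb; congr (_ ^+ _ * _);
    case: b c {IH hy} => [] [].
- by rewrite mulrDl IH IH' -[LHS]mulrDr -[y * x + _]mulrDr.
- by rewrite mulNr IH !mulrN.
Qed.

Definition even_elt : {pred R} := fun x => `[< graded false x >].

Lemma even_eltP x : reflect (graded false x) (x \in even_elt).
Proof. exact: asboolP. Qed.

Lemma even_elt_subring : subring_closed even_elt.
Proof.
split; first exact/even_eltP/graded1.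
  move=> x y /even_eltP hx /even_eltP hy; apply/even_eltP.
  by apply: gradedD => //; exact: gradedN.
move=> x y /even_eltP hx /even_eltP hy; apply/even_eltP.
exact: (gradedM hx hy).
Qed.

HB.instance Definition _ := GRing.isSubringClosed.Build R even_elt
  even_elt_subring.

(** The anticommutation proof is a parameter of the type so that the commutative ring instance can
    be attached to it. *)
Definition even_ring of (forall i j, e i * e j = - (e j * e i)) :=
  {x : R | x \in even_elt}.
End Even.

Section EvenRing.
Variables (R : nzRingType) (e : nat -> R).
Variable eC : forall i j, e i * e j = - (e j * e i).

HB.instance Definition _ := SubChoice.on (even_ring eC).
HB.instance Definition _ := [SubChoice_isSubNzRing of even_ring eC by <:].

Lemma even_ring_mulC : commutative (@GRing.mul (even_ring eC)).
Proof.
move=> x y; apply: val_inj; rewrite !rmorphM /=.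
have /even_eltP hx := valP x; have /even_eltP hy := valP y.
by rewrite (graded_comm eC hx hy) mul1r.
Qed.

HB.instance Definition _ :=
  GRing.PzRing_hasCommutativeMul.Build (even_ring eC) even_ring_mulC.
End EvenRing.

(** The pure tensor of r and A in the tensor product of R with integer matrices; products are
    computed factor by factor because integers are central in R. *)
Definition gmx (R : pzRingType) m n (r : R) (A : 'M[int]_(m, n)) : 'M[R]_(m, n) :=
  \matrix_(i, j) (r *~ A i j).

Lemma gmxM (R : pzRingType) m n p r s (A : 'M[int]_(m, n)) (B : 'M[int]_(n, p)) :
  gmx r A *m gmx s B = gmx (r * s : R) (A *m B).
Proof.
apply/matrixP => i j; rewrite !mxE mulrz_sumr; apply: eq_bigr => k _.
by rewrite !mxE mulrzAl mulrzAr -mulrzA mulrC.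
Qed.

Lemma gmx_prod (R : pzRingType) n (I : Type) (s : seq I) (r : I -> R) A :
  \prod_(i <- s) gmx (r i) (A i) =
    gmx (\prod_(i <- s) r i) (\prod_(i <- s) A i : 'M[int]_n).
Proof.
elim: s => [|i s IH]; last by rewrite !big_cons IH [LHS]gmxM.
by rewrite !big_nil; apply/matrixP => i j; rewrite !mxE; case: eqP.
Qed.

(** * Rosset's nilpotency argument and the resulting identity *)

Section Rosset.
Variables (R : nzRingType) (e : nat -> R).
Hypothesis tfR : torsion_free R.
Hypothesis eC : forall i j, e i * e j = - (e j * e i).
Variables (n : nat) (X : 'M[R]_n.+1).
Hypothesis oddX : forall i j, graded e true (X i j).

Let gradedX k i j : graded e (odd k) ((X ^+ k) i j).
Proof.
elim: k i j => [|k IH] i j.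
  by rewrite mxE; case: eqP => _; [exact: graded1|exact: graded0].
rewrite exprS mxE; apply: graded_sum => l _ /=.
exact: gradedM (oddX _ _) (IH _ _).
Qed.

(** Write the power as the product of the odd matrices X and X^(2k+1). Their entries anticommute, so
    cyclicity of the trace holds up to a sign and the trace equals its opposite. *)
Let trX k : \tr (X ^+ k.+1.*2) = 0.
Proof.
have h : \tr (X ^+ k.+1.*2) = - \tr (X ^+ k.+1.*2).
  rewrite -[k.+1.*2]/(k.*2.+2) {1}exprS [in RHS]exprSr /mxtrace -sumrN.
  under eq_bigr => i _ do rewrite mxE.
  under [RHS]eq_bigr => i _ do rewrite mxE -sumrN.
  rewrite exchange_big; apply: eq_bigr => i _; apply: eq_bigr => j _ /=.
  have hX := gradedX k.*2.+1 i j; rewrite /= odd_double in hX.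
  by rewrite (graded_comm eC (oddX _ _) hX) mulN1r.
by apply: (@tfR _ 1); rewrite mulr2n {1}h addNr.
Qed.

(* The even part is commutative, so Newton's identities apply to [X ^+ 2],
   whose powers all have zero trace. *)
Lemma odd_mx_nilpotent : X ^+ n.+1.*2 = 0.
Proof.
have evX i j : (X ^+ 2) i j \in even_elt e by exact/even_eltP/(gradedX 2).
pose B : 'M[even_ring eC]_n.+1 := \matrix_(i, j) (exist (fun x => x \in even_elt
  e) _ (evX i j) : even_ring eC).
have BE : map_mx val B = X ^+ 2 by apply/matrixP => i j; rewrite !mxE.
have BXE k : map_mx val (B ^+ k) = X ^+ k.*2 by rewrite rmorphXn /= BE -exprM
  mul2n.
have tfE : torsion_free (even_ring eC).
  move=> x k /(congr1 val); rewrite raddfMn /= => /tfR h.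
  exact: val_inj.
have := nilpotent_of_trace_eq0 tfE (B := B).
move=> h; rewrite -BXE h ?raddf0 // => -[//|k _].
by apply: val_inj; rewrite -trace_map_mx BXE trX.
Qed.
End Rosset.

(** Anticommutation carries a repeated generator next to its twin, where the square vanishes. *)
Lemma prod_anticomm_eq0 (R : nzRingType) (e : nat -> R) (s : seq nat) :
  (forall i, e i * e i = 0) -> (forall i j, e i * e j = - (e j * e i)) ->
  ~~ uniq s -> \prod_(i <- s) e i = 0.
Proof.
move=> ee eC; elim: s => //= i s IH; rewrite negb_and negbK big_cons.
case/orP=> [|/IH ->]; last by rewrite mulr0.
elim: s {IH} => //= j s IH; rewrite inE big_cons.
case: (eqVneq i j) => [-> _|_ /= /IH h]; first by rewrite mulrA ee mul0r.
by rewrite mulrA eC mulNr -mulrA h mulr0 oppr0.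
Qed.

Lemma amitsur_levitzki_int n : exists c : 'S_(n.+1.*2) -> int,
  c 1%g = 1 /\ forall A : 'I_(n.+1.*2) -> 'M[int]_n.+1,
    \sum_s c s *: \prod_(i < n.+1.*2) A (s i) = 0.
Proof.
have [m em] : exists m, m = n.+1.*2 by exists n.+1.*2.
rewrite -em.
have [R [e [phi [tfR ee eC phi1]]]] := grassmann_ring m.
exists (fun s : 'S_m => phi (\prod_(i < m) e (s i))); split=> [|A].
  by rewrite -[RHS]phi1; congr (phi _); apply: eq_bigr => i _; rewrite perm1.
pose X : 'M[R]_n.+1 := \sum_(i < m) gmx (e i) (A i).
have oddX i j : graded e true (X i j).
  rewrite summxE; apply: graded_sum => k _.
  by rewrite mxE; apply/gradedZ/graded_gen.
have := odd_mx_nilpotent tfR eC oddX; rewrite -em => X0.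
apply/matrixP => j k.
have E0 : phi ((X ^+ m) j k) = 0 by rewrite X0 mxE raddf0.
rewrite summxE [RHS]mxE -[RHS]E0 -[m in X ^+ m]card_ord -prodr_const.
(* The power X^m expands over all index functions. Those repeating an index contribute zero; the
   injective ones are the permutations and yield the identity. *)
rewrite (bigA_distr_bigA (fun _ i : 'I_m => gmx (e i) (A i))) /= summxE
  raddf_sum /=.
rewrite [RHS](bigID (fun f : {ffun 'I_m -> 'I_m} => injectiveb f)) /=.
rewrite [X in _ + X]big1 ?addr0 => [|f nf]; last first.
  rewrite gmx_prod mxE -(big_map (fun i => f i : nat) xpredT) prod_anticomm_eq0
    //.
    by rewrite mul0rz raddf0.
  by apply: contra nf; rewrite (map_comp val) => /map_uniq;
    rewrite [index_enum _]unlock -enumT.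
rewrite (reindex (@pval _)) /=; last first.
  pose in_Sn := insubd (1%g : 'S_m).
  by exists in_Sn => /= f Uf; first apply: val_inj; apply: insubdK.
apply: eq_big => /= [s | s _]; rewrite ?(valP s) // gmx_prod !mxE raddfMz.
by rewrite -mulrzz pvalE.
Qed.

(** Matrix units have integer entries, so on them the identity is the image of the integral one;
    multilinearity extends it to all matrices. *)
Lemma amitsur_levitzki n : (0 < n)%N -> exists c : 'S_(n.*2) -> int,
  c 1%g = 1 /\ forall (K : comNzRingType) (A : 'I_(n.*2) -> 'M[K]_n),
    \sum_s (c s)%:~R *: \prod_(i < n.*2) A (s i) = 0.
Proof.
case: n => // n _; have [c [c1 c0]] := amitsur_levitzki_int n.
move: (n.+1.*2) c c1 c0 => m c c1 c0.
exists c; split=> // K A; pose P := ('I_n.+1 * 'I_n.+1)%type.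
pose dl (S : pzRingType) (p : P) : 'M[S]_n.+1 := delta_mx p.1 p.2.
have AE j : A j = \sum_(p : P) A j p.1 p.2 *: dl K p.
  rewrite {1}[A j]matrix_sum_delta (pair_bigA _ (fun i k => A j i k *: delta_mx
    i k)).
  by [].
have prodE (s : 'S_m) : \prod_(i < m) A (s i) =
    \sum_(f : {ffun 'I_m -> P}) (\prod_j A j (f j).1 (f j).2) *:
       \prod_i dl K (f (s i)).
  under eq_bigr => i _ do rewrite AE.
  rewrite (bigA_distr_bigA (fun i p => A (s i) p.1 p.2 *: dl K p)) /=.
  (* Composing f with s makes the scalar factor the product over j of the entries of [A j] at [f j].
     It no longer depends on s and leaves the sum over permutations. *)
  rewrite (reindex (fun f : {ffun 'I_m -> P} => [ffun i => f (s i)])) /=;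
    last first.
    exists (fun f : {ffun 'I_m -> P} => [ffun i => f ((s^-1)%g i)]) => f _;
      by apply/ffunP => i; rewrite !ffunE ?permK ?permKV.
  apply: eq_bigr => f _; rewrite scaler_prod [in RHS](reindex_inj (@perm_inj _
    s)) /=.
  by congr (_ *: _); apply: eq_bigr => i _; rewrite ffunE.
under eq_bigr => s _ do rewrite prodE scaler_sumr.
rewrite exchange_big big1 //= => f _.
under eq_bigr => s _ do rewrite scalerA mulrC -scalerA.
rewrite -scaler_sumr.
have := congr1 (map_mx (intr : int -> K)) (c0 (fun j => dl int (f j))).
rewrite raddf0 raddf_sum /= => e;
  rewrite -[X in _ *: X = _](_ : 0 = _) ?scaler0 // -[LHS]e.
apply: eq_bigr => s _; rewrite map_mxZ rmorph_prod; congr (_ *: _).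
by apply: eq_bigr => i _; apply/matrixP => a b; rewrite !mxE rmorph_nat.
Qed.

(** * The degree of an identity of a matrix algebra *)

Section Staircase.
Variables (K : nzRingType) (n : nat).

Definition stair k : 'M[K]_n.+1 := delta_mx (inord k./2) (inord (uphalf k)).

(** The column of each step is the row of the next, since [uphalf k] is [k.+1./2], so the product
    follows a path starting at 0. *)
Lemma stair_prod_neq0 d : \prod_(i < d) stair i != 0.
Proof.
suff h : (\prod_(i < d) stair i) 0 (inord d./2) = 1.
  by apply/eqP => e; move: h; rewrite e mxE => /eqP; rewrite eq_sym oner_eq0.
elim: d => [|d IH].
  by rewrite big_ord0 mxE (_ : inord _ = 0) //; apply/val_inj; rewrite /= inordK.
rewrite big_ord_recr mxE (bigD1 (inord d./2)) //= IH mxE !eqxx mul1r big1 ?addr0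
  //.
by move=> k /negbTE kd; rewrite mxE kd mulr0.
Qed.

(** If neighbours x, y have nonzero product then [uphalf x = y./2], whence x <= y. The bound 2n
    keeps all row and column indices at most n, where [inord] is faithful. *)
Lemma stair_prod_sorted (w : seq nat) : {in w, forall k, k <= n.*2}%N ->
  \prod_(k <- w) stair k != 0 -> sorted leq w.
Proof.
elim: w => [|x [|y w] IH] //= hw; rewrite 2!big_cons mulrA => nz.
have hy : (y <= n.*2)%N by apply: hw; rewrite !inE eqxx orbT.
have hx : (x <= n.*2)%N by apply: hw; rewrite !inE eqxx.
have {}IH : path leq y w.
  apply: IH => [k hk|]; first by apply: hw; rewrite inE hk orbT.
  by apply: contra_neq nz; rewrite big_cons -mulrA => ->; rewrite mulr0.
rewrite IH andbT; apply: contra_neqT nz; rewrite -ltnNge => yx.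
rewrite [stair x * stair y]mul_delta_mx_cond; case: eqP => [/(congr1 val)|_].
  rewrite /= !inordK => [e| |]; last 2 first.
  - by rewrite ltnS -(doubleK n) half_leq.
  - by rewrite ltnS uphalf_half -leq_double doubleD; lia.
  lia.
by rewrite mulr0n mul0r.
Qed.

Lemma leq_multilinear_identityS d (c : 'S_d -> K) (s0 : 'S_d) : c s0 = 1 ->
  (forall B : 'I_d -> 'M[K]_n.+1, \sum_s c s *: \prod_(i < d) B (s i) = 0) ->
  (n.+1.*2 <= d)%N.
Proof.
move=> c1 id0; rewrite leqNgt doubleS; apply/negP => hd.
have dn (i : 'I_d) : (i <= n.*2)%N.
  by have := ltn_ord i; lia.
(* Twisting by the inverse of s0 makes the monomial of s0 read the staircase in order; a degree
   below 2n + 2 keeps its indices at most 2n. *)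
have /= := id0 (fun j => stair ((s0^-1)%g j)).
rewrite (bigD1 s0) //= c1 scale1r [X in _ + X]big1 ?addr0.
  move/eqP; apply/negP; under eq_bigr => i _ do rewrite permK.
  exact: stair_prod_neq0.
move=> s; apply: contraNeq => nz; apply/eqP/permP => i.
(* A surviving monomial lists 0, ..., d - 1 in increasing order, which forces t to be the identity
   and s = s0. *)
pose t := (s * s0^-1)%g; pose w := [seq val (t i) | i <- enum 'I_d].
have ws : sorted leq w.
  apply: stair_prod_sorted => [_ /mapP[j _ ->]|]; first exact: dn.
  apply: contra_neq nz => h; rewrite -[RHS](scaler0 _ (c s)) -h /w big_map.
  by rewrite enumT [index_enum _]unlock; congr (_ *: _); apply: eq_bigr => j _;
    rewrite permM.
have wE : w = map val (enum 'I_d).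
  apply: (sorted_eq leq_trans anti_leq) => //.
    by rewrite val_enum_ord iota_sorted.
  rewrite /w (map_comp val t) perm_map // uniq_perm ?enum_uniq //.
    by rewrite map_inj_uniq ?enum_uniq //; exact: perm_inj.
  by move=> j; rewrite mem_enum; apply/mapP; exists ((t^-1)%g j);
    rewrite ?mem_enum ?permKV.
have /val_inj := (eq_in_map _ _ _).2 wE i (mem_enum _ i).
by rewrite permM => /(congr1 s0); rewrite permKV.
Qed.
End Staircase.

Lemma leq_multilinear_identity (K : nzRingType) n d (c : 'S_d -> K) (s0 : 'S_d) :
  (0 < n)%N -> c s0 = 1 ->
  (forall B : 'I_d -> 'M[K]_n, \sum_s c s *: \prod_(i < d) B (s i) = 0) ->
  (n.*2 <= d)%N.
Proof. by case: n => // n _; exact: leq_multilinear_identityS. Qed.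

(** * Cyclic representations of the rank one quantum Weyl algebra *)

Section CyclicShift.
Variables (l : nat).

Lemma val_iter_ordS d (i : 'I_l) : iter d (@ordS l) i = ((i + d) %% l)%N :> nat.
Proof.
elim: d => [|d IH] /=; first by rewrite addn0 modn_small.
by rewrite IH -addn1 modnDml addn1 addnS.
Qed.

Lemma iter_ordS_trans (i j : 'I_l) : exists d, iter d (@ordS l) i = j.
Proof.
exists (j + (l - i))%N; apply/val_inj; rewrite /= val_iter_ordS.
by rewrite addnCA subnKC ?modnDr ?modn_small // ltnW.
Qed.

Lemma expr_ordS (R : nzRingType) (r : R) (i : 'I_l) :
  r ^+ l = 1 -> r ^+ ordS i = r ^+ i.+1.
Proof. by move=> rl; rewrite /= expr_mod. Qed.
End CyclicShift.

(** If p is nonzero, then p X + 1 is not constant; any root of it is nonzero and is not a root of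
    p. *)
Lemma poly_eq0_of_unit_roots (K : closedFieldType) (p : {poly K}) :
  (forall x, x != 0 -> p.[x] = 0) -> p = 0.
Proof.
move=> h; apply/eqP; apply: contraT => p0.
have /closed_rootP[x] : size (p * 'X + 1) != 1%N.
  by rewrite size_MXaddC (negbTE p0) /= eqSS size_poly_eq0.
rewrite /root hornerD hornerMX hornerC.
have [->|x0] := eqVneq x 0; first by rewrite mulr0 add0r oner_eq0.
by rewrite h // mul0r add0r oner_eq0.
Qed.

Lemma coef_prod_linear (R : comNzRingType) c (a : nat -> R) b m : (c <= m)%N ->
  (\prod_(k < c) (a k *: 'X - b%:P))`_m =
    if m == c then \prod_(k < c) a k else 0.
Proof.
elim: c m => [|c IH] m cm; first by rewrite !big_ord0 coef1; case: eqP.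
case: m cm => // m cm; rewrite !big_ord_recr /= mulrBr -scalerAr coefB coefZ.
rewrite coefMX coefMC /= !IH ?(ltnW cm) // eqSS [m.+1 == c]gtn_eqF // mul0r subr0.
by case: eqP; rewrite ?mulr0 // mulrC.
Qed.

Section CyclicRep.
Variables (K : fieldType) (l : nat) (q : K).

(** For X, Y such weighted shifts, YX is diagonal with entries u_i and XY with entries u_(i+1), so
    the relation becomes u_(i+1) = q u_i + 1. The weights of [shiftY] give the solution u_i = a g
    q^i - 1/(q - 1), which closes up cyclically when q^l = 1. *)
Definition shiftX (a : K) : 'M[K]_l := \matrix_(i, j) (a *+ (j == ordS i)).
Definition shiftY (a g : K) : 'M[K]_l :=
  \matrix_(i, j) ((g * q ^+ i - ((q - 1) * a)^-1) *+ (i == ordS j)).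
Definition dmx (f : 'I_l -> K) : 'M[K]_l := diag_mx (\row_i f i).

Lemma dmxM f g : dmx f * dmx g = dmx (fun i => f i * g i).
Proof. by rewrite [LHS]mulmx_diag; congr diag_mx; apply/rowP => i;
  rewrite !mxE. Qed.

Lemma dmxE f i j : dmx f i j = f i *+ (i == j).
Proof. by rewrite mxE mxE. Qed.

Lemma shiftX_mulE a A i j : (shiftX a * A) i j = a * A (ordS i) j.
Proof.
rewrite mxE (bigD1 (ordS i)) //= mxE eqxx big1 ?addr0 // => k /negbTE ki.
by rewrite mxE ki mul0r.
Qed.

Lemma shiftY_mulE a g A i j :
  (shiftY a g * A) i j = (g * q ^+ i - ((q - 1) * a)^-1) * A (ord_pred i) j.
Proof.
rewrite mxE (bigD1 (ord_pred i)) //= mxE ord_predK eqxx big1 ?addr0 // => k ki.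
by rewrite mxE -(inj_eq (can_inj (@ord_predK l))) ordSK eq_sym (negbTE ki) mul0r.
Qed.

Lemma dmx_mulE f A i j : (dmx f * A) i j = f i * A i j.
Proof. by rewrite [dmx f * A]mul_diag_mx mxE mxE. Qed.

(** Y steps backward and X forward along the cycle. The entry is a polynomial in [g] of degree at
    most c, times a^d; linear independence rests on this. *)
Lemma shift_monomialE a g c d i j :
  (shiftY a g ^+ c * shiftX a ^+ d) i j =
    (\prod_(k < c) (g * q ^+ iter k (@ord_pred l) i - ((q - 1) * a)^-1)) *
      (a ^+ d *+ (j == iter d (@ordS l) (iter c (@ord_pred l) i))).
Proof.
elim: c i => [|c IH] i /=.
  rewrite expr0 mul1r big_ord0 mul1r.
  elim: d i => [|d IH] i; first by rewrite mxE eq_sym.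
  by rewrite exprS shiftX_mulE IH exprS mulrnAr -iterSr.
rewrite exprS -mulrA shiftY_mulE IH mulrA big_ord_recl -iterSr; congr (_ * _ * _).
by apply: eq_bigr => k _; rewrite -iterSr.
Qed.

Hypotheses (q1 : q != 1) (ql : q ^+ l = 1).

Lemma shiftYX a g : a != 0 ->
  shiftY a g * shiftX a = dmx (fun i => a * g * q ^+ i - (q - 1)^-1).
Proof.
move=> a0; apply/matrixP => i j; rewrite shiftY_mulE dmxE mxE ord_predK eq_sym.
case: eqP => _; rewrite ?mulr1n ?mulr0n ?mulr0 // invfM mulrBl mulfVK //.
by rewrite mulrAC [g * a]mulrC.
Qed.

Lemma shiftXY a g : a != 0 ->
  shiftX a * shiftY a g = dmx (fun i => q * (a * g * q ^+ i) - (q - 1)^-1).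
Proof.
move=> a0; apply/matrixP => i j; rewrite shiftX_mulE dmxE mxE.
rewrite (inj_eq (can_inj (@ordSK l))); case: eqP => _;
  rewrite ?mulr1n ?mulr0n ?mulr0 //.
rewrite expr_ordS // exprS invfM mulrBr.
rewrite [a * (_^-1 * _)]mulrCA divff // mulr1; congr (_ - _).
by ring.
Qed.

Lemma shift_weyl a g : a != 0 ->
  shiftX a * shiftY a g - q *: (shiftY a g * shiftX a) = 1.
Proof.
move=> a0; rewrite shiftXY // shiftYX //; apply/matrixP => i j.
rewrite mxE [X in _ + X]mxE [X in _ - X]mxE !dmxE !mxE.
case: eqP => _; rewrite ?mulr1n ?mulr0n ?mulr0 ?subr0 //.
by field; rewrite subr_eq0.
Qed.

Lemma shift_weyl_diag a g : a != 0 ->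
  1 + (q - 1) *: (shiftY a g * shiftX a) = dmx (fun i => (q - 1) * (a * g * q ^+
    i)).
Proof.
move=> a0; rewrite shiftYX //; apply/matrixP => i j.
rewrite mxE [X in _ + X]mxE !dmxE mxE.
case: eqP => _; rewrite ?mulr1n ?mulr0n ?mulr0 ?addr0 //.
by field; rewrite subr_eq0.
Qed.

Lemma shiftX_dmx a r s : r ^+ l = 1 ->
  shiftX a * dmx (fun i => s * r ^+ i) = r *: (dmx (fun i => s * r ^+ i) *
    shiftX a).
Proof.
move=> rl; apply/matrixP => i j.
rewrite shiftX_mulE [RHS]mxE dmx_mulE dmxE mxE [ordS i == j]eq_sym.
case: eqP => _; last by rewrite !mulr0.
by rewrite !mulr1n expr_ordS // exprS; ring.
Qed.

Lemma shiftY_dmx a g r s : r != 0 -> r ^+ l = 1 ->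
  shiftY a g * dmx (fun i => s * r ^+ i) = r^-1 *: (dmx (fun i => s * r ^+ i) *
    shiftY a g).
Proof.
move=> r0 rl; apply/matrixP => i j.
rewrite shiftY_mulE [RHS]mxE dmx_mulE dmxE mxE -(inj_eq (can_inj (@ordSK l)))
  ord_predK.
case: eqP => _; last by rewrite !mulr0.
have -> : r ^+ i = r * r ^+ ord_pred i by rewrite -exprS -expr_ordS // ord_predK.
rewrite !mulr1n.
by move: ((q - 1) * a)^-1 => t; field.
Qed.
End CyclicRep.

(** * The two shifts generate the full matrix algebra *)

Section CyclicRepGeneration.
Variables (K : fieldType) (l : nat) (q : K).
Hypotheses (q1 : q != 1) (q_prim : l.-primitive_root q).
Variables (a g : K) (C : 'M[K]_l -> Prop).
Hypotheses (a0 : a != 0) (g0 : g != 0).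
Hypotheses (C1 : C 1) (CD : forall A B, C A -> C B -> C (A + B)).
Hypotheses (CZ : forall k A, C A -> C (k *: A)).
Hypotheses (CM : forall A B, C A -> C B -> C (A * B)).
Hypotheses (CX : C (shiftX l a)) (CY : C (shiftY l q a g)).

(** YX yields the diagonal matrix of the q^i, whose entries are distinct; polynomials in it give the
    diagonal matrix units, and powers of X move these to any column. [C] is an arbitrary closed
    predicate so that it can express membership in an image on either tensor factor. *)
Lemma shift_generate A : C A.
Proof.
have C0 : C 0 by rewrite -(scale0r (1 : 'M[K]_l)); exact: CZ.
have Csum (I : finType) (F : I -> 'M[K]_l) : (forall i, C (F i)) ->
  C (\sum_i F i).
  by move=> h; elim/big_ind: _.
have q10 : q - 1 != 0 by rewrite subr_eq0.
have Cq : C (dmx (fun i => q ^+ i)).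
  have -> : dmx (fun i : 'I_l => q ^+ i) =
      ((q - 1) * (a * g))^-1 *: (1 + (q - 1) *: (shiftY l q a g * shiftX l a)).
    rewrite shift_weyl_diag //; apply/matrixP => i j; rewrite [RHS]mxE !dmxE.
    case: eqP => _; rewrite ?mulr1n ?mulr0n ?mulr0 //.
    by field; rewrite q10 a0 g0.
  by apply/CZ/CD => //; apply/CZ/CM.
have Cdelta i : C (delta_mx i i).
  pose D (s : seq 'I_l) : 'M[K]_l := dmx (fun j => \prod_(k <- s) (q ^+ j - q ^+
    k)).
  have CD' s : C (D s).
    elim: s => [|k s IH].
      rewrite (_ : D _ = 1) //; apply/matrixP => u v.
      by rewrite dmxE big_nil mxE.
    have -> : D (k :: s) = dmx (fun j => q ^+ j - q ^+ k) * D s.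
      by rewrite dmxM; apply/matrixP => u v; rewrite !dmxE big_cons.
    have -> : dmx (fun j : 'I_l => q ^+ j - q ^+ k) =
        dmx (fun j => q ^+ j) + (- q ^+ k) *: (1 : 'M[K]_l).
      apply/matrixP => u v; rewrite [RHS]mxE [X in _ + X]mxE !dmxE mxE.
      by case: eqP; rewrite ?mulr1n ?mulr0n ?mulr0 ?addr0 // mulr1.
    by apply: CM => //; apply: CD => //; exact: CZ.
  (* Lagrange interpolation at the points q^k: the product over k != i vanishes everywhere except at
     position i, where primitivity of q makes it nonzero. *)
  pose s := [seq k <- enum 'I_l | k != i].
  pose c := \prod_(k <- s) (q ^+ i - q ^+ k).
  have c0 : c != 0.
    rewrite prodf_seq_neq0; apply/allP => k; rewrite mem_filter => /andP[ki _] /=.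
    rewrite subr_eq0 (eq_prim_root_expr q_prim) !modn_small //.
    by apply: contra ki => /eqP /val_inj ->.
  have -> : delta_mx i i = c^-1 *: D s.
    apply/matrixP => u v; rewrite [RHS]mxE dmxE mxE [v == i]eq_sym.
    have [->|ui] := eqVneq u i.
      by case: eqP => _ /=; rewrite ?mulr1n ?mulVf // mulr0.
    rewrite (big_rem u) /= ?subrr ?mul0r ?mul0rn ?mulr0 //.
    by rewrite /s mem_filter ui mem_enum.
  exact: CZ.
rewrite [A]matrix_sum_delta; apply: (Csum) => i; apply: (Csum) => j; apply: CZ.
have [d dE] := iter_ordS_trans i j.
have CXd : C (shiftX l a ^+ d).
  by elim: d {dE} => [|d IH] //; rewrite exprS; exact: CM.
have -> : delta_mx i j = (a ^+ d)^-1 *: (delta_mx i i * shiftX l a ^+ d).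
  apply/matrixP => u v; rewrite mxE [RHS]mxE [X in _ * X]mxE (bigD1 i) //= mxE
    eqxx andbT.
  rewrite big1 ?addr0 => [|k /negbTE ki]; last by rewrite mxE ki andbF mul0r.
  have := shift_monomialE q a g 0 d i v;
    rewrite expr0 mul1r big_ord0 mul1r /= dE => ->.
  case: (u == i); rewrite ?mul0r ?mulr0 // mul1r.
  case: (v == j); rewrite ?mulr0 // mulr1n mulVf //.
  exact: expf_neq0.
by apply/CZ/CM.
Qed.
End CyclicRepGeneration.

(** * Independence of the shift monomials over the parameters *)

Section CyclicRepIndependence.
Variables (K : closedFieldType) (l : nat) (q : K).
Hypotheses (l_gt0 : (0 < l)%N) (q0 : q != 0).

Lemma shift_monomials_free M N (w : nat -> nat -> K) :
  (forall a g, a != 0 -> g != 0 ->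
     \sum_(c < M) \sum_(d < N) w c d *: (shiftY l q a g ^+ c * shiftX l a ^+ d)
       = 0) ->
  forall c d, (c < M)%N -> (d < N)%N -> w c d = 0.
Proof.
elim: M => [|M IH] h // c d cM dN.
pose i0 := Ordinal l_gt0; pose it := iter M (@ord_pred l) i0.
pose qs := \prod_(k < M) q ^+ iter k (@ord_pred l) i0.
have qs0 : qs != 0 by apply/prodf_neq0 => k _; exact: expf_neq0.
pose qk k := q ^+ iter k (@ord_pred l) i0.
(* For fixed [a], row 0 is a polynomial in [g] in which degree M comes from Y^M alone. Its
   coefficient there carries the factor [qs], a product of powers of q. *)
have topa a j : a != 0 -> \sum_(d < N) w M d * (a ^+ d *+ (j == iter d (@ordS l)
  it)) = 0.
  move=> a0; pose kp c : {poly K} := \prod_(k < c)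
    (q ^+ iter k (@ord_pred l) i0 *: 'X - (((q - 1) * a)^-1)%:P).
  pose p : {poly K} := \sum_(c < M.+1) \sum_(d < N)
    (w c d * (a ^+ d *+ (j == iter d (@ordS l) (iter c (@ord_pred l) i0)))) *:
      kp c.
  have p0 : p = 0.
    apply: poly_eq0_of_unit_roots => g g0.
    have /matrixP/(_ i0 j) := h a g a0 g0; rewrite summxE [RHS]mxE => <-.
    rewrite horner_sum; apply: eq_bigr => c' _; rewrite summxE horner_sum.
    apply: eq_bigr => d' _; rewrite hornerZ mxE shift_monomialE -mulrA;
      congr (_ * _).
    rewrite mulrC; congr (_ * _); rewrite horner_prod; apply: eq_bigr => k _.
    by rewrite hornerD hornerN hornerC hornerZ hornerX mulrC.
  have := congr1 (fun p : {poly K} => p`_M) p0;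
    rewrite coef0 coef_sum big_ord_recr /=.
  rewrite big1 ?add0r => [|c' _]; last first.
    rewrite coef_sum big1 // => d' _; rewrite coefZ /kp (coef_prod_linear qk);
      last exact: ltnW.
    by rewrite gtn_eqF ?mulr0.
  rewrite coef_sum => e; apply: (mulIf qs0); rewrite mul0r -[RHS]e mulr_suml.
  by apply: eq_bigr => d' _; rewrite coefZ /kp (coef_prod_linear qk) // eqxx.
(* The column reached by X^d' retains the exponents congruent to d' modulo l; letting [a] vary
   separates them. *)
have wM d' : (d' < N)%N -> w M d' = 0.
  move=> dN'; pose j := iter d' (@ordS l) it.
  pose p : {poly K} := \poly_(d < N) (w M d *+ (j == iter d (@ordS l) it)).
  have p0 : p = 0.
    apply: poly_eq0_of_unit_roots => a a0;
      rewrite -[RHS](topa a j a0) horner_poly.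
    by apply: eq_bigr => d0 _; rewrite mulrnAl mulrnAr.
  have := congr1 (fun p : {poly K} => p`_d') p0.
  by rewrite coef0 coef_poly dN' eqxx.
move: cM; rewrite ltnS leq_eqVlt => /orP[/eqP ->|cM]; first exact: wM.
apply: IH => // a g a0 g0; rewrite -[RHS](h a g a0 g0) big_ord_recr /=.
by rewrite [X in _ = _ + X]big1 ?addr0 // => d' _; rewrite wM ?scale0r.
Qed.
End CyclicRepIndependence.

(** * Presented algebras and the ordered monomials *)

Section PresentedAlgebra.
Variables (K : comNzRingType) (X : choiceType) (rels : seq (free_alg K X)).
Local Notation P := (presented rels).

Lemma free_alg_ind (Q : free_alg K X -> Prop) :
  (forall f g, Q f -> Q g -> Q (f + g)) -> (forall c f, Q f -> Q (c *: f)) ->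
  Q 1 -> (forall i f, Q f -> Q (free_gen K i * f)) -> forall f, Q f.
Proof.
move=> QD QZ Q1 Qg f.
have Q0 : Q 0 by rewrite -(scale0r 1); exact: QZ.
rewrite [f]monalgE; elim/big_ind: _ => // m _.
rewrite (_ : << _ *g _ >> = f@_m *: << m >>); last first.
  by apply/malgP => k; rewrite mcoeffZ !mcoeffU mulr_natr.
apply: QZ; case: m => s; elim: s => [|i s IH]; first by rewrite -fmoneE.
rewrite (_ : << FMonom _ >> = free_gen K i * << FMonom s >>); first exact: Qg.
by rewrite malgM_def fgmulUU mulr1 fmuE; congr << _ >>;
  rewrite -[RHS]/(fmmul _ _) fmmulE.
Qed.

Lemma presented_ind (Q : P -> Prop) :
  (forall u v, Q u -> Q v -> Q (u + v)) -> (forall c u, Q u -> Q (c *: u)) ->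
  Q 1 -> (forall i u, Q u -> Q (\pi_P (free_gen K i) * u)) -> forall u, Q u.
Proof.
move=> QD QZ Q1 Qg u; have [f ->] := presentedE u.
elim/free_alg_ind: f => [f g Qf Qg'|c f Qf||i f Qf].
- by rewrite pi_presentedD; exact: QD.
- by rewrite pi_presentedZ; exact: QZ.
- exact: Q1.
- by rewrite pi_presentedM; exact: Qg.
Qed.

Variables (B : algType K) (g : X -> B).

Let h (m : {fmonom X}) : B := \prod_(i <- (m : seq X)) g i.

Let h_morph : mmorphism h.
Proof.
split=> [m1 m2|]; rewrite /h; last by rewrite fm1 big_nil.
by rewrite fmM big_cat.
Qed.

HB.instance Definition _ := isMultiplicative.Build _ _ h h_morph.

Definition free_eval : free_alg K X -> B := mmap (GRing.in_alg B) h.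

Lemma free_eval_gen i : free_eval (free_gen K i) = g i.
Proof. by rewrite /free_eval mmapU /= scale1r mul1r /h fmuE /= big_seq1. Qed.

Lemma free_evalZ c f : free_eval (c *: f) = c *: free_eval f.
Proof. by rewrite /free_eval mmapZ /= mulr_algl. Qed.

Lemma free_evalD : {morph free_eval : f g / f + g}. Proof. exact: mmapD. Qed.
Lemma free_evalB : {morph free_eval : f g / f - g}. Proof. exact: mmapB. Qed.
Lemma free_eval0 : free_eval 0 = 0. Proof. exact: mmap0. Qed.
Lemma free_eval1 : free_eval 1 = 1. Proof. exact: mmap1. Qed.
Lemma free_evalM : {morph free_eval : f g / f * g}.
Proof.
have [] // := @commr_mmap_is_multiplicative _ _ _ (GRing.in_alg B) h.
by move=> f m m'; rewrite /GRing.comm mulr_algl mulr_algr.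
Qed.

Hypothesis eval_rels : forall r, r \in rels -> free_eval r = 0.

(** Universal property of the presentation. The laws are listed one by one because [presented rels]
    may be the zero ring, hence is not an [algType]. *)
Lemma presented_lift : exists rho : P -> B,
  [/\ {morph rho : u v / u + v}, {morph rho : u v / u * v}, rho 1 = 1,
      forall c u, rho (c *: u) = c *: rho u &
      forall i, rho (\pi_P (free_gen K i)) = g i].
Proof.
have ev0 f : f \in ideal_gen rels -> free_eval f = 0.
  move=> /ideal_genP[s hs ->].
  rewrite (big_morph free_eval free_evalD free_eval0) big_seq big1 // => t ts.
  by rewrite !free_evalM (eval_rels (allP hs t ts)) mulr0 mul0r.
pose rho (u : P) := free_eval (repr u).
have rhoE f : rho (\pi_P f) = free_eval f.
  by apply/eqP; rewrite -subr_eq0 -free_evalB ev0 // repr_presented.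
exists rho; split.
- move=> u v; have [f ->] := presentedE u; have [f' ->] := presentedE v.
  by rewrite -pi_presentedD !rhoE free_evalD.
- move=> u v; have [f ->] := presentedE u; have [f' ->] := presentedE v.
  by rewrite -[_ * _]pi_presentedM !rhoE free_evalM.
- by rewrite -free_eval1 -rhoE.
- move=> c u; have [f ->] := presentedE u.
  by rewrite -[_ *: _]pi_presentedZ !rhoE free_evalZ.
- by move=> i; rewrite rhoE free_eval_gen.
Qed.
End PresentedAlgebra.

(** * Straightening products into ordered monomials *)

Section QCommutation.
Variables (K : fieldType) (A : algType K).
Implicit Types (u v x y z : A) (k q : K).

Lemma qcomm_exprr u v k n : u * v = k *: (v * u) ->
  u * v ^+ n = k ^+ n *: (v ^+ n * u).
Proof.
move=> uv; elim: n => [|n IH]; first by rewrite !expr0 mulr1 mul1r scale1r.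
rewrite exprS mulrA uv -scalerAl -(mulrA v u) IH -scalerAr scalerA (exprS k).
by rewrite mulrA.
Qed.

Lemma qcomm_exprl u v k n : u * v = k *: (v * u) ->
  u ^+ n * v = k ^+ n *: (v * u ^+ n).
Proof.
move=> uv; elim: n => [|n IH]; first by rewrite !expr0 mulr1 mul1r scale1r.
rewrite exprSr -mulrA uv -scalerAr (mulrA (u ^+ n)) IH -scalerAl scalerA (exprS
  k).
by rewrite mulrA.
Qed.

(** Serves both pairs of generators, with remainder 1 or [z1]. The scalar s is the q-integer 1 + q +
    ... + q^n, whose value is irrelevant for spanning. *)
Lemma qweyl_exprr x y z q n : x * y = q *: (y * x) + z -> z * y = y * z ->
  exists s, x * y ^+ n.+1 = q ^+ n.+1 *: (y ^+ n.+1 * x) + s *: (z * y ^+ n).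
Proof.
move=> xy zy; elim: n => [|n [s IH]].
  by exists 1; rewrite !expr1 scale1r mulr1.
have zyn m : y ^+ m * z = z * y ^+ m.
  by elim: m => [|m IHm]; rewrite ?mul1r ?mulr1 // exprSr -mulrA -zy mulrA IHm
    mulrA.
have e1 : y ^+ n.+1 * x * y = q *: (y ^+ n.+2 * x) + z * y ^+ n.+1.
  by rewrite -mulrA xy mulrDr -scalerAr mulrA -exprSr zyn.
exists (q ^+ n.+1 + s); rewrite [in LHS](exprSr y) mulrA IH mulrDl -!scalerAl e1.
by rewrite scalerDr scalerA -(exprSr q) -(mulrA z) -(exprSr y) -addrA -scalerDl.
Qed.
End QCommutation.

Section QuantumWeylRelations.
Variables (K : fieldType) (A : algType K) (q1 q2 lam : K) (x1 y1 x2 y2 : A).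
Hypotheses (q10 : q1 != 0) (lam0 : lam != 0).
(** It commutes with y2, so it can serve as the remainder for the second pair, and it commutes with
    x1 up to the scalar q1, so it can be moved back among the first generators. *)
Let z1 : A := 1 + (q1 - 1) *: (y1 * x1).
Hypotheses (x1x2 : x1 * x2 = (q1 * lam) *: (x2 * x1))
  (x1y2 : x1 * y2 = lam^-1 *: (y2 * x1)) (y1y2 : y1 * y2 = lam *: (y2 * y1))
  (y1x2 : y1 * x2 = (q1^-1 * lam^-1) *: (x2 * y1))
  (x1y1 : x1 * y1 = q1 *: (y1 * x1) + 1) (x2y2 : x2 * y2 = q2 *: (y2 * x2) + z1).

Let x2x1 : x2 * x1 = (q1 * lam)^-1 *: (x1 * x2).
Proof. by rewrite x1x2 scalerA mulVf ?scale1r // mulf_neq0. Qed.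
Let y2x1 : y2 * x1 = lam *: (x1 * y2).
Proof. by rewrite x1y2 scalerA mulfV ?scale1r. Qed.
Let y2y1 : y2 * y1 = lam^-1 *: (y1 * y2).
Proof. by rewrite y1y2 scalerA mulVf ?scale1r. Qed.
Let x2y1 : x2 * y1 = (q1 * lam) *: (y1 * x2).
Proof. by rewrite y1x2 scalerA -invfM mulfV ?scale1r // mulf_neq0. Qed.

Let x1z1 : x1 * z1 = q1 *: (z1 * x1).
Proof.
rewrite /z1 mulrDr mulr1 -scalerAr mulrA x1y1 mulrDl mul1r mulrDl mul1r.
rewrite !scalerDr -!scalerAl !scalerA addrCA scalerBl scale1r [x1 + _]addrC subrK.
by rewrite addrC mulrC.
Qed.

Let z1y2 : z1 * y2 = y2 * z1.
Proof.
rewrite /z1 mulrDl mulrDr mul1r mulr1 -scalerAl -scalerAr; congr (_ + _ *: _).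
rewrite -mulrA x1y2 -scalerAr mulrA y1y2 -scalerAl scalerA mulVf // scale1r.
by rewrite mulrA.
Qed.

Definition pbw (t : nat * nat * (nat * nat)) : A :=
  y1 ^+ t.1.1 * x1 ^+ t.1.2 * (y2 ^+ t.2.1 * x2 ^+ t.2.2).

Definition in_pbw_span (u : A) :=
  exists s : seq (K * (nat * nat * (nat * nat))), u = \sum_(t <- s) t.1 *: pbw
    t.2.

Lemma in_pbw_spanD u v : in_pbw_span u -> in_pbw_span v -> in_pbw_span (u + v).
Proof. by move=> [s ->] [t ->]; exists (s ++ t); rewrite big_cat. Qed.

Lemma in_pbw_spanZ k u : in_pbw_span u -> in_pbw_span (k *: u).
Proof.
move=> [s ->]; exists [seq (k * t.1, t.2) | t <- s].
by rewrite big_map scaler_sumr; apply: eq_bigr => t _; rewrite scalerA.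
Qed.

Lemma pbw_in_span a b c d : in_pbw_span (y1 ^+ a * x1 ^+ b * (y2 ^+ c * x2 ^+ d)).
Proof. by exists [:: (1, (a, b, (c, d)))]; rewrite big_seq1 scale1r. Qed.

Lemma in_pbw_span_mull v :
  (forall t, in_pbw_span (v * pbw t)) -> forall u, in_pbw_span u ->
    in_pbw_span (v * u).
Proof.
move=> h _ [s ->]; elim: s => [|t s IH].
  by exists [::]; rewrite !big_nil mulr0.
by rewrite big_cons mulrDr -scalerAr; apply: in_pbw_spanD => //;
  exact: in_pbw_spanZ.
Qed.

Lemma y1_pbw t : in_pbw_span (y1 * pbw t).
Proof.
case: t => -[a b] [c d]; rewrite /pbw !mulrA -exprS -mulrA; exact: pbw_in_span.
Qed.

Lemma x1_pbw t : in_pbw_span (x1 * pbw t).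
Proof.
case: t => -[[|a] b] [c d]; rewrite /pbw /=.
  by rewrite mul1r mulrA -exprS -[x1 ^+ b.+1]mul1r; exact: (pbw_in_span 0).
have [|s e] := qweyl_exprr a x1y1; first by rewrite mul1r mulr1.
rewrite !(mulrA x1) e mul1r 2!mulrDl -!scalerAl -(mulrA (y1 ^+ a.+1)) -exprS.
by apply: in_pbw_spanD; apply: in_pbw_spanZ; exact: pbw_in_span.
Qed.

Lemma y2_pbw t : in_pbw_span (y2 * pbw t).
Proof.
case: t => -[a b] [c d]; rewrite /pbw /= !(mulrA y2) (qcomm_exprr a y2y1).
rewrite -!scalerAl -(mulrA _ y2) (qcomm_exprr b y2x1) -scalerAr -scalerAl.
rewrite (mulrA (y1 ^+ a)) -(mulrA _ y2) (mulrA y2) -exprS.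
by do 2!apply: in_pbw_spanZ; exact: pbw_in_span.
Qed.

(** Moving x2 past y1 and x1 costs scalars. Crossing a power of y2 leaves a remainder containing
    [z1], which is carried left past x1^b and expanded, giving the exponents (a, b) and (a + 1, b +
    1). *)
Lemma x2_pbw t : in_pbw_span (x2 * pbw t).
Proof.
case: t => -[a b] [c d]; rewrite /pbw /= !(mulrA x2) (qcomm_exprr a x2y1).
rewrite -!scalerAl -(mulrA _ x2) (qcomm_exprr b x2x1) -scalerAr -scalerAl.
rewrite (mulrA (y1 ^+ a)) -(mulrA _ x2) (mulrA x2); do 2!apply: in_pbw_spanZ.
case: c => [|c].
  by rewrite mulr1 -exprS -[x2 ^+ _]mul1r; exact: (pbw_in_span _ _ 0).
have [s e] := qweyl_exprr c x2y2 z1y2.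
rewrite e mulrDl mulrDr -scalerAl -scalerAr; apply: in_pbw_spanD.
  by apply: in_pbw_spanZ; rewrite -(mulrA (y2 ^+ _)) -exprS; exact: pbw_in_span.
rewrite -scalerAl -scalerAr; apply: in_pbw_spanZ.
rewrite -(mulrA z1) (mulrA _ z1) -(mulrA _ (x1 ^+ b)) (qcomm_exprl b x1z1).
rewrite -scalerAr -scalerAl; apply: in_pbw_spanZ.
rewrite /z1 mulrDl mul1r mulrDr mulrDl; apply: in_pbw_spanD;
  first exact: pbw_in_span.
rewrite -scalerAl -scalerAr -scalerAl; apply: in_pbw_spanZ.
by rewrite -(mulrA y1) -exprS (mulrA (y1 ^+ a)) -exprSr; exact: pbw_in_span.
Qed.

End QuantumWeylRelations.

Section QuantumWeylBasis.
Variables (K : fieldType) (q1 q2 lam : K) (q1_neq1 : q1 != 1).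
Local Notation A := (qweyl2 q1 q2 lam q1_neq1).
Local Notation PA := (presented (qweyl2_rels q1 q2 lam)).

Definition weyl_x1 : A := \pi_PA (Wx1 K).
Definition weyl_y1 : A := \pi_PA (Wy1 K).
Definition weyl_x2 : A := \pi_PA (Wx2 K).
Definition weyl_y2 : A := \pi_PA (Wy2 K).

Lemma pi_rel_eq f g : f - g \in qweyl2_rels q1 q2 lam -> \pi_PA f = \pi_PA g.
Proof.
move=> h; apply/pi_presentedP/ideal_genP; exists [:: (1, f - g, 1)].
  by rewrite /= h.
by rewrite big_seq1 mul1r mulr1.
Qed.

Let rel_mem k : (k < 6)%N -> (qweyl2_rels q1 q2 lam)`_k \in qweyl2_rels q1 q2 lam.
Proof. by move=> ?; apply: (mem_nth 0). Qed.

Let piM f g : \pi_PA (f * g) = (\pi_PA f : A) * (\pi_PA g : A) :> A.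
Proof. exact: pi_presentedM. Qed.

Let piZ k f : \pi_PA (k *: f) = k *: (\pi_PA f : A) :> A.
Proof. exact: pi_presentedZ. Qed.

Let piD f g : \pi_PA (f + g) = (\pi_PA f : A) + (\pi_PA g : A) :> A.
Proof. exact: pi_presentedD. Qed.

Lemma weyl_x1x2 : weyl_x1 * weyl_x2 = (q1 * lam) *: (weyl_x2 * weyl_x1).
Proof. by rewrite /weyl_x1 /weyl_x2 -!piM -piZ;
  exact/pi_rel_eq/(@rel_mem 0 isT). Qed.

Lemma weyl_x1y2 : weyl_x1 * weyl_y2 = lam^-1 *: (weyl_y2 * weyl_x1).
Proof. by rewrite /weyl_x1 /weyl_y2 -!piM -piZ;
  exact/pi_rel_eq/(@rel_mem 1 isT). Qed.

Lemma weyl_y1y2 : weyl_y1 * weyl_y2 = lam *: (weyl_y2 * weyl_y1).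
Proof. by rewrite /weyl_y1 /weyl_y2 -!piM -piZ;
  exact/pi_rel_eq/(@rel_mem 2 isT). Qed.

Lemma weyl_y1x2 : weyl_y1 * weyl_x2 = (q1^-1 * lam^-1) *: (weyl_x2 * weyl_y1).
Proof. by rewrite /weyl_y1 /weyl_x2 -!piM -piZ;
  exact/pi_rel_eq/(@rel_mem 3 isT). Qed.

Lemma weyl_x1y1 : weyl_x1 * weyl_y1 = q1 *: (weyl_y1 * weyl_x1) + 1.
Proof.
rewrite /weyl_x1 /weyl_y1 -!piM -piZ -[1]/(\pi_PA 1 : A) -piD; apply: pi_rel_eq.
by rewrite opprD addrA; exact: (@rel_mem 4 isT).
Qed.

Lemma weyl_x2y2 : weyl_x2 * weyl_y2 =
  q2 *: (weyl_y2 * weyl_x2) + (1 + (q1 - 1) *: (weyl_y1 * weyl_x1)).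
Proof.
rewrite /weyl_x1 /weyl_y1 /weyl_x2 /weyl_y2 -!piM -!piZ -[1]/(\pi_PA 1 : A) -!piD.
apply: pi_rel_eq.
by rewrite opprD addrA; exact: (@rel_mem 5 isT).
Qed.

Hypotheses (q10 : q1 != 0) (lam0 : lam != 0).

Lemma pbw_span u : in_pbw_span weyl_x1 weyl_y1 weyl_x2 weyl_y2 u.
Proof.
elim/(@presented_ind K _ (qweyl2_rels q1 q2 lam)): u => [u v|k u||i u hu].
- exact: (@in_pbw_spanD _ A).
- exact: (@in_pbw_spanZ _ A).
- have := @pbw_in_span _ A weyl_x1 weyl_y1 weyl_x2 weyl_y2 0 0 0 0.
  by rewrite !expr0 !mulr1.
have [->|->|->|->] : [\/ i = inord 0, i = inord 1, i = inord 2 | i = inord 3].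
  case: i => -[|[|[|[|//]]]] hi;
    [constructor 1|constructor 2|constructor 3|constructor 4];
    by apply/val_inj; rewrite /= inordK.
- apply: (@in_pbw_span_mull _ A _ _ _ _ weyl_x1) hu.
  exact: (@x1_pbw _ A q1 _ _ _ _ weyl_x1y1).
- apply: (@in_pbw_span_mull _ A _ _ _ _ weyl_y1) hu.
  exact: (@y1_pbw _ A).
- apply: (@in_pbw_span_mull _ A _ _ _ _ weyl_x2) hu.
  exact: (@x2_pbw _ A q1 q2 lam _ _ _ _ q10 lam0 weyl_x1x2 weyl_x1y2
    weyl_y1y2 weyl_y1x2 weyl_x1y1 weyl_x2y2).
- apply: (@in_pbw_span_mull _ A _ _ _ _ weyl_y2) hu.
  exact: (@y2_pbw _ A lam _ _ _ _ lam0 weyl_x1y2 weyl_y1y2).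
Qed.
End QuantumWeylBasis.

(** * Tensor representations and the PI-degree *)

Section AlgebraMorphism.
Variables (K : fieldType) (A : algType K) (n : nat).

(** Stated law by law because the size l1 l2 is not syntactically positive, while an [algType] is
    nonzero. *)
Definition alg_morph (rho : A -> 'M[K]_n) :=
  [/\ {morph rho : u v / u + v}, {morph rho : u v / u * v}, rho 1 = 1 &
      forall k u, rho (k *: u) = k *: rho u].

Variable rho : A -> 'M[K]_n.
Hypothesis hrho : alg_morph rho.

Lemma alg_morph0 : rho 0 = 0.
Proof. by have [_ _ _ rZ] := hrho; rewrite -(scale0r 0) rZ scale0r. Qed.

Lemma alg_morph_sum I (r : seq I) (F : I -> A) :
  rho (\sum_(i <- r) F i) = \sum_(i <- r) rho (F i).
Proof. by have [rD _ _ _] := hrho; exact: (big_morph rho rD alg_morph0). Qed.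

Lemma alg_morph_prod I (r : seq I) (F : I -> A) :
  rho (\prod_(i <- r) F i) = \prod_(i <- r) rho (F i).
Proof. by have [_ rM r1 _] := hrho; exact: (big_morph rho rM r1). Qed.

Lemma alg_morphX u k : rho (u ^+ k) = rho u ^+ k.
Proof.
have [_ rM r1 _] := hrho.
by elim: k => [|k IH]; rewrite ?r1 // !exprS rM IH.
Qed.

Lemma alg_morph_multilinear d (c : 'S_d -> K) (a : 'I_d -> A) :
  rho (\sum_s c s *: \prod_(i < d) a (s i)) =
    \sum_s c s *: \prod_(i < d) rho (a (s i)).
Proof.
have [_ _ _ rZ] := hrho; rewrite alg_morph_sum; apply: eq_bigr => s _.
by rewrite rZ alg_morph_prod.
Qed.

Lemma alg_morph_pbw x y x' y' t : rho (pbw x y x' y' t) =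
  rho y ^+ t.1.1 * rho x ^+ t.1.2 * (rho y' ^+ t.2.1 * rho x' ^+ t.2.2).
Proof. by have [_ rM _ _] := hrho; rewrite !rM !alg_morphX. Qed.
End AlgebraMorphism.

Section Representations.
Variables (K : fieldType) (q1 q2 lam : K) (q1_neq1 : q1 != 1).
Local Notation A := (qweyl2 q1 q2 lam q1_neq1).

Definition weyl_rep n (X1 Y1 X2 Y2 : 'M[K]_n) (rho : A -> 'M[K]_n) :=
  alg_morph (rho : (A : algType K) -> 'M[K]_n) /\
      [/\ rho (weyl_x1 q2 lam q1_neq1) = X1, rho (weyl_y1 q2 lam q1_neq1) = Y1,
          rho (weyl_x2 q2 lam q1_neq1) = X2 & rho (weyl_y2 q2 lam q1_neq1) = Y2].

Lemma weyl_rep_exists n (X1 Y1 X2 Y2 : 'M[K]_n) : (0 < n)%N ->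
  X1 * X2 = (q1 * lam) *: (X2 * X1) -> X1 * Y2 = lam^-1 *: (Y2 * X1) ->
  Y1 * Y2 = lam *: (Y2 * Y1) -> Y1 * X2 = (q1^-1 * lam^-1) *: (X2 * Y1) ->
  X1 * Y1 = q1 *: (Y1 * X1) + 1 ->
  X2 * Y2 = q2 *: (Y2 * X2) + (1 + (q1 - 1) *: (Y1 * X1)) ->
  exists rho, weyl_rep X1 Y1 X2 Y2 rho.
Proof.
case: n X1 Y1 X2 Y2 => // n X1 Y1 X2 Y2 _ xx xy yy yx xy1 xy2.
pose g (i : 'I_4) : 'M[K]_n.+1 := [:: X1; Y1; X2; Y2]`_i.
have e1 : free_eval g (Wx1 K) = X1 by rewrite /Wx1 free_eval_gen /g inordK.
have e2 : free_eval g (Wy1 K) = Y1 by rewrite /Wy1 free_eval_gen /g inordK.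
have e3 : free_eval g (Wx2 K) = X2 by rewrite /Wx2 free_eval_gen /g inordK.
have e4 : free_eval g (Wy2 K) = Y2 by rewrite /Wy2 free_eval_gen /g inordK.
have evR f f' k h h' : free_eval g (f * f' - k *: (h * h')) =
    free_eval g f * free_eval g f' - k *: (free_eval g h * free_eval g h').
  by rewrite free_evalB free_evalZ !free_evalM.
have ev0 r : r \in qweyl2_rels q1 q2 lam -> free_eval g r = 0.
  rewrite !inE => /or4P[/eqP->|/eqP->|/eqP->|/or3P[] /eqP->].
  - by rewrite evR e1 e3 [X1 * X2]xx subrr.
  - by rewrite evR e1 e4 [X1 * Y2]xy subrr.
  - by rewrite evR e2 e4 [Y1 * Y2]yy subrr.
  - by rewrite evR e2 e3 [Y1 * X2]yx subrr.
  - by rewrite free_evalB evR e1 e2 free_eval1 [X1 * Y1]xy1 addrAC addrK subrr.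
  - rewrite free_evalB evR e3 e4 free_evalD free_eval1 free_evalZ free_evalM e1
      e2.
    by rewrite [X2 * Y2]xy2 addrAC addrK subrr.
have [rho [rD rM r1 rZ rg]] := presented_lift ev0.
exists rho; split; first by split.
by split; rewrite [LHS]rg /g inordK.
Qed.

End Representations.

(** * Kronecker products and the twisted representations *)

Section Tensor.
Variables (K : comNzRingType) (m n : nat).
Implicit Types (A : 'M[K]_m) (B : 'M[K]_n).

Lemma tensmxZl k A B : (k *: A) *t B = k *: (A *t B).
Proof. by apply/matrixP => i j; rewrite !mxE mulrA. Qed.

Lemma tensmxZr k A B : A *t (k *: B) = k *: (A *t B).
Proof. by apply/matrixP => i j; rewrite !mxE mulrCA. Qed.

Lemma tensmxDl A A' B : (A + A') *t B = A *t B + A' *t B.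
Proof. by apply/matrixP => i j; rewrite !mxE mulrDl. Qed.

Lemma tensmxDr A B B' : A *t (B + B') = A *t B + A *t B'.
Proof. by apply/matrixP => i j; rewrite !mxE mulrDr. Qed.

Lemma tensmxM A A' B B' : (A *t B) * (A' *t B') = (A * A') *t (B * B').
Proof. by rewrite [LHS]tensmx_mul. Qed.

Lemma tens_delta_mx (p q : 'I_(m * n)) :
  delta_mx p q = delta_mx (mxtens_unindex p).1 (mxtens_unindex q).1 *t
    delta_mx (mxtens_unindex p).2 (mxtens_unindex q).2 :> 'M[K]_(m * n).
Proof.
have unE (i j : 'I_(m * n)) : ((mxtens_unindex i).1 == (mxtens_unindex j).1) &&
    ((mxtens_unindex i).2 == (mxtens_unindex j).2) = (i == j).
  by rewrite -xpair_eqE -!surjective_pairing (can_eq (@mxtens_unindexK m n)).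
apply/matrixP => i j; rewrite !mxE -(unE i p) -(unE j q).
by do 4!case: (_ == _); rewrite /= ?mulr0 ?mul0r ?mulr1.
Qed.

Lemma tensmx11 : (1 : 'M[K]_m) *t (1 : 'M[K]_n) = 1.
Proof.
apply/matrixP => i j; rewrite !mxE -[i == j](can_eq (@mxtens_unindexK m n)).
rewrite [mxtens_unindex i]surjective_pairing [mxtens_unindex
  j]surjective_pairing xpair_eqE.
by case: eqP; case: eqP; rewrite /= ?mulr0 ?mul0r ?mulr1.
Qed.

Lemma tensmxX A B k : (A *t B) ^+ k = A ^+ k *t B ^+ k.
Proof. by elim: k => [|k IH]; rewrite ?expr0 ?tensmx11 // !exprS IH tensmxM. Qed.
End Tensor.

Section TensorRep.
Variables (K : fieldType) (q1 q2 lam : K) (l1 l2 : nat).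

(* Diagonal matrices twisting the second pair of generators: their product is
   [1 + (q1 - 1) y1 x1] acting on the first tensor factor. *)
Definition twistX : 'M[K]_l1 := dmx (fun i => 1 * (q1 * lam) ^+ i).
Definition twistY (a g : K) : 'M[K]_l1 :=
  dmx (fun i => ((q1 - 1) * (a * g)) * lam^-1 ^+ i).

Definition repX1 (a : K) : 'M[K]_(l1 * l2) := shiftX l1 a *t 1.
Definition repY1 (a g : K) : 'M[K]_(l1 * l2) := shiftY l1 q1 a g *t 1.
Definition repX2 (b : K) : 'M[K]_(l1 * l2) := twistX *t shiftX l2 b.
Definition repY2 (a g b h : K) : 'M[K]_(l1 * l2) := twistY a g *t shiftY l2 q2 b
  h.

Hypotheses (q10 : q1 != 0) (q11 : q1 != 1) (q21 : q2 != 1) (lam0 : lam != 0).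
Hypotheses (q1l : q1 ^+ l1 = 1) (q2l : q2 ^+ l2 = 1) (laml : lam ^+ l1 = 1).
Variables (a g b h : K).
Hypotheses (a0 : a != 0) (b0 : b != 0).

Let qll : (q1 * lam) ^+ l1 = 1. Proof. by rewrite exprMn q1l laml mulr1. Qed.
Let lamVl : lam^-1 ^+ l1 = 1. Proof. by rewrite exprVn laml invr1. Qed.

Lemma twistX_twistY : twistX * twistY a g = 1 + (q1 - 1) *: (shiftY l1 q1 a g *
  shiftX l1 a).
Proof.
rewrite shift_weyl_diag // dmxM; congr dmx; apply/funext => i.
by rewrite mul1r exprMn exprVn; field; rewrite expf_neq0.
Qed.

Lemma repX1_repX2 : repX1 a * repX2 b = (q1 * lam) *: (repX2 b * repX1 a).
Proof. by rewrite !tensmxM mulr1 mul1r shiftX_dmx // tensmxZl. Qed.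

Lemma repX1_repY2 : repX1 a * repY2 a g b h = lam^-1 *: (repY2 a g b h * repX1 a).
Proof. by rewrite !tensmxM mulr1 mul1r shiftX_dmx // tensmxZl. Qed.

Lemma repY1_repY2 : repY1 a g * repY2 a g b h = lam *: (repY2 a g b h * repY1 a
  g).
Proof. by rewrite !tensmxM mulr1 mul1r shiftY_dmx ?invr_neq0 // invrK tensmxZl.
  Qed.

Lemma repY1_repX2 : repY1 a g * repX2 b = (q1^-1 * lam^-1) *: (repX2 b * repY1 a
  g).
Proof. by rewrite !tensmxM mulr1 mul1r shiftY_dmx ?mulf_neq0 // invfM tensmxZl.
  Qed.

Lemma repX1_repY1 : repX1 a * repY1 a g = q1 *: (repY1 a g * repX1 a) + 1.
Proof.
rewrite !tensmxM mulr1 -tensmxZl -tensmx11 -tensmxDl; congr (_ *t _).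
by rewrite -(shift_weyl q11 q1l g a0) addrC subrK.
Qed.

(** The twists commute, so their product factors out on the left of the tensor and the rank one
    relation X Y - q2 Y X = 1 remains on the right. *)
Lemma repX2_repY2 : repX2 b * repY2 a g b h = q2 *: (repY2 a g b h * repX2 b) +
  (1 + (q1 - 1) *: (repY1 a g * repX1 a)).
Proof.
rewrite !tensmxM mulr1 -(tensmxZl (q1 - 1)) -tensmx11 -tensmxDl -twistX_twistY.
have -> : twistY a g * twistX = twistX * twistY a g.
  by rewrite !dmxM; congr dmx; apply/funext => i; rewrite mulrC.
by rewrite -tensmxZr -tensmxDr -(shift_weyl q21 q2l h b0) addrC subrK.
Qed.
End TensorRep.

Section Regroup.
Variables (K : pzRingType).
Local Notation quad := (nat * nat * (nat * nat))%type.

Definition pbw_coef (s : seq (K * quad)) (t : quad) : K :=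
  \sum_(u <- s | u.2 == t) u.1.

(** A list may repeat an exponent, so coefficients are first collected. The exponents of the second
    pair come outermost, since the second tensor factor is separated first. *)
Lemma sum_pbw_coef (V : lmodType K) (s : seq (K * quad)) (G : quad -> V) n :
  all (fun u => [&& u.2.1.1 < n, u.2.1.2 < n, u.2.2.1 < n & u.2.2.2 < n]%N) s ->
  \sum_(u <- s) u.1 *: G u.2 =
  \sum_(c < n) \sum_(d < n) \sum_(a < n) \sum_(b < n)
    pbw_coef s (a : nat, b : nat, (c : nat, d : nat)) *:
      G (a : nat, b : nat, (c : nat, d : nat)).
Proof.
move=> sn; pose toq (p : 'I_n * 'I_n * ('I_n * 'I_n)) : quad :=
  (p.2.1 : nat, p.2.2 : nat, (p.1.1 : nat, p.1.2 : nat)).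
transitivity (\sum_p pbw_coef s (toq p) *: G (toq p)); last first.
  rewrite pair_bigA /=; under [RHS]eq_bigr => p _ do rewrite pair_bigA /=.
  by rewrite pair_bigA /=.
under [RHS]eq_bigr => p _ do rewrite scaler_suml big_mkcond /=.
rewrite exchange_big /=; apply: eq_big_seq => -[k [[a b] [c d]]] us /=.
have /and4P[/= an bn cn dn] := allP sn _ us.
rewrite (bigD1 (Ordinal cn, Ordinal dn, (Ordinal an, Ordinal bn))) //= eqxx.
rewrite big1 ?addr0 // => -[[c' d'] [a' b']] ne; case: eqP => //= -[ea eb ec ed].
case/eqP: ne; congr (_, _, (_, _)); exact/val_inj.
Qed.

Lemma exists_pbw_bound (s : seq (K * quad)) :
  exists n, all (fun u => [&& u.2.1.1 < n, u.2.1.2 < n, u.2.2.1 < n & u.2.2.2 <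
    n]%N) s.
Proof.
exists (\sum_(u <- s) (u.2.1.1 + u.2.1.2 + u.2.2.1 + u.2.2.2)).+1.
apply/allP => u us; rewrite (big_rem u) //= !ltnS.
by apply/and4P; split; lia.
Qed.
End Regroup.

Lemma dmxX (K : fieldType) l (f : 'I_l ->
  K) k : dmx f ^+ k = dmx (fun i => f i ^+ k).
Proof.
elim: k => [|k IH]; last by rewrite exprS IH dmxM; congr dmx; apply/funext => i;
  rewrite exprS.
by apply/matrixP => i j; rewrite dmxE !mxE.
Qed.

Lemma mulr_dmx_eq0 (K : fieldType) l (f : 'I_l -> K) (P : 'M[K]_l) :
  (forall i, f i != 0) -> P * dmx f = 0 -> P = 0.
Proof.
move=> f0 /matrixP e; apply/matrixP => i j; have := e i j.
rewrite [P * _]mul_mx_diag !mxE => /eqP; rewrite mulf_eq0 (negbTE (f0 j)) orbF.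
by move/eqP.
Qed.

Lemma mulr_dmxV (K : fieldType) l (f : 'I_l -> K) :
  (forall i, f i != 0) -> dmx (fun i => (f i)^-1) * dmx f = 1.
Proof.
move=> f0; rewrite dmxM; apply/matrixP => i j; rewrite dmxE mxE.
by rewrite mulVf.
Qed.

Lemma scale_mulmxl (K : pzRingType) l k (P Q : 'M[K]_l) : (k *: P) * Q = k *: (P
  * Q).
Proof. by rewrite [RHS]scalemxAl. Qed.

(** * Joint faithfulness, surjectivity and the PI-degree *)

Section PIdegreeTensor.
Variables (K : closedFieldType) (q1 q2 lam : K) (l1 l2 : nat).
Hypotheses (q10 : q1 != 0) (q11 : q1 != 1) (q20 : q2 != 0) (q21 : q2 != 1).
Hypotheses (lam0 : lam != 0).
Hypotheses (q1p : l1.-primitive_root q1) (q2p : l2.-primitive_root q2).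
Variables (A : algType K) (x1 y1 x2 y2 : A).
Hypothesis span : forall u, in_pbw_span x1 y1 x2 y2 u.
Hypothesis reps : forall a g b h, a != 0 -> g != 0 -> b != 0 -> h != 0 ->
  exists rho : A -> 'M[K]_(l1 * l2), alg_morph rho /\
    [/\ rho x1 = repX1 l1 l2 a, rho y1 = repY1 q1 l1 l2 a g,
        rho x2 = repX2 q1 lam l1 l2 b & rho y2 = repY2 q1 q2 lam l1 l2 a g b h].

Let l1_gt0 : (0 < l1)%N := prim_order_gt0 q1p.
Let l2_gt0 : (0 < l2)%N := prim_order_gt0 q2p.

Let twistX_neq0 (i : 'I_l1) : 1 * (q1 * lam) ^+ i != 0.
Proof. by rewrite mul1r expf_neq0 // mulf_neq0. Qed.

Let twistY_neq0 a g (i : 'I_l1) : a != 0 -> g != 0 ->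
  ((q1 - 1) * (a * g)) * lam^-1 ^+ i != 0.
Proof. by move=> a0 g0; rewrite !mulf_neq0 ?subr_eq0 // expf_neq0 // invr_neq0.
  Qed.

(** Independence is applied twice. With a, g and an entry of the first factor fixed, varying b, h
    isolates each pair of exponents of y2 and x2; varying a, g then isolates those of y1 and x1. *)
Lemma rep_separates u : (forall rho : A -> 'M[K]_(l1 * l2), alg_morph rho ->
  rho u = 0) ->
  u = 0.
Proof.
move=> hu; have [s us] := span u; have [n sn] := exists_pbw_bound s.
pose w i j k l := pbw_coef s (i, j, (k, l)).
suff w0 i j k l : (i < n)%N -> (j < n)%N -> (k < n)%N -> (l < n)%N ->
  w i j k l = 0.
  rewrite us (sum_pbw_coef _ sn) big1 // => k _; rewrite big1 // => l _.
  rewrite big1 // => i _; rewrite big1 // => j _.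
  by rewrite [pbw_coef _ _](w0 i j k l) // scale0r.
move=> hi hj hk hl.
apply: (shift_monomials_free l1_gt0 q10 (w := fun i j => w i j k l) _ hi hj) =>
  a g a0 g0.
pose N := twistY q1 lam l1 a g; pose M := twistX q1 lam l1.
pose P k l := \sum_(i < n) \sum_(j < n) w i j k l *: (shiftY l1 q1 a g ^+ i *
  shiftX l1 a ^+ j).
(* The twists N and M do not involve b or h, so they belong to the coefficients of the second-factor
   monomials. Being invertible diagonal matrices, they are cancelled afterwards. *)
have PNM0 k' l' : (k' < n)%N -> (l' < n)%N -> P k' l' * (N ^+ k' * M ^+ l') = 0.
  move=> hk' hl'; apply/matrixP => e f; rewrite [RHS]mxE.
  apply: (shift_monomials_free l2_gt0 q20
    (w := fun k l => (P k l * (N ^+ k * M ^+ l)) e f) _ hk' hl') => b h b0 h0.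
  have [rho [rhoA [r1 r2 r3 r4]]] := reps a0 g0 b0 h0.
  have rho0 := hu _ rhoA; have [_ _ _ rZ] := rhoA.
  apply/matrixP => e' f'.
  have := congr1 (fun B : 'M[K]_(l1 * l2) => B (mxtens_index (e, e'))
    (mxtens_index (f, f'))) rho0.
  rewrite us (alg_morph_sum rhoA) mxE => e0; rewrite [RHS]mxE -[RHS]e0.
  under [in RHS]eq_bigr => t _.
    rewrite rZ (alg_morph_pbw rhoA) r1 r2 r3 r4 !tensmxX !expr1n !tensmxM mulr1
      mul1r.
    over.
  rewrite (sum_pbw_coef (fun t => (shiftY l1 q1 a g ^+ t.1.1 * shiftX l1 a ^+
    t.1.2 * (N ^+ t.2.1 * M ^+ t.2.2)) *t
     (shiftY l2 q2 b h ^+ t.2.1 * shiftX l2 b ^+ t.2.2)) sn).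
  rewrite !summxE; apply: eq_bigr => k1 _; rewrite !summxE;
    apply: eq_bigr => l1' _.
  rewrite mxE mulr_suml summxE summxE mulr_suml; apply: eq_bigr => i1 _.
  rewrite mulr_suml summxE summxE mulr_suml; apply: eq_bigr => j1 _.
  rewrite [RHS]mxE tensmxE mulrA; congr (_ * _).
  by rewrite scale_mulmxl mxE.
have := PNM0 k l hk hl; rewrite !dmxX dmxM; apply: mulr_dmx_eq0 => i'.
by apply: mulf_neq0; apply: expf_neq0; [exact: twistY_neq0|exact: twistX_neq0].
Qed.

Let surj_left (P : 'M[K]_l1) (rho : A -> 'M[K]_(l1 * l2)) : alg_morph rho ->
  rho x1 = repX1 l1 l2 1 -> rho y1 = repY1 q1 l1 l2 1 1 ->
    exists u, rho u = P *t 1.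
Proof.
move=> [rD rM r1 rZ] rx ry; move: P.
apply: (shift_generate q11 q1p (oner_neq0 _) (oner_neq0 _)) => [|P Q|k P|P Q||].
- by exists 1; rewrite r1 tensmx11.
- by move=> [u hu] [v hv]; exists (u + v); rewrite rD hu hv tensmxDl.
- by move=> [u hu]; exists (k *: u); rewrite rZ hu tensmxZl.
- by move=> [u hu] [v hv]; exists (u * v); rewrite rM hu hv tensmxM mulr1.
- by exists x1.
- by exists y1.
Qed.

(** With all parameters equal to 1, the image contains the left factor, then the right one, hence
    all matrix units as tensors of matrix units. *)
Lemma exists_rep_onto : exists rho : A -> 'M[K]_(l1 * l2),
  alg_morph rho /\ forall B, exists u, rho u = B.
Proof.
have n1 := oner_neq0 K.
have [rho [rhoA [e1 e2 e3 e4]]] := reps n1 n1 n1 n1.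
exists rho; split=> //.
have left P := surj_left P rhoA e1 e2; have [rD rM r1 rZ] := rhoA.
have right : forall P : 'M[K]_l2, exists u, rho u = 1 *t P.
  apply: (shift_generate q21 q2p n1 n1) => [|P Q|k P|P Q||].
  - by exists 1; rewrite r1 tensmx11.
  - by move=> [u hu] [v hv]; exists (u + v); rewrite rD hu hv tensmxDr.
  - by move=> [u hu]; exists (k *: u); rewrite rZ hu tensmxZr.
  - by move=> [u hu] [v hv]; exists (u * v); rewrite rM hu hv tensmxM mulr1.
  (* The image of x2 is a twist tensored with a shift; multiplying by a preimage of the inverse
     twist leaves the shift alone on the second factor. The same works for y2. *)
  - have [u hu] := left (dmx (fun i => (1 * (q1 * lam) ^+ i)^-1)).
    by exists (u * x2); rewrite rM hu e3 tensmxM (mulr_dmxV twistX_neq0) mul1r.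
  - have [u hu] := left (dmx (fun i => (((q1 - 1) * (1 * 1)) * lam^-1 ^+ i)^-1)).
    have tY0 i := twistY_neq0 i n1 n1.
    by exists (u * y2); rewrite rM hu e4 tensmxM (mulr_dmxV tY0) mul1r.
have delta p q : exists u, rho u = delta_mx p q.
  have [u hu] := left (delta_mx (mxtens_unindex p).1 (mxtens_unindex q).1).
  have [v hv] := right (delta_mx (mxtens_unindex p).2 (mxtens_unindex q).2).
  by exists (u * v); rewrite rM hu hv tensmxM mulr1 mul1r tens_delta_mx.
move=> B; rewrite [B]matrix_sum_delta.
have sums (I : finType) (F : I -> 'M[K]_(l1 * l2)) :
    (forall i, exists u, rho u = F i) -> exists u, rho u = \sum_i F i.
  move=> /fin_all_exists[u hu]; exists (\sum_i u i).
  by rewrite (alg_morph_sum rhoA); apply: eq_bigr.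
apply: (sums) => p; apply: (sums) => q; have [u hu] := delta p q.
by exists (B p q *: u); rewrite rZ hu.
Qed.

Lemma PI_degree_tensor : PI_degree A (l1 * l2)%N.
Proof.
have l12_gt0 : (0 < l1 * l2)%N by rewrite muln_gt0 l1_gt0.
split=> [|d [c [s0 cs0] cid]].
  have [c [c1 c0]] := amitsur_levitzki l12_gt0.
  exists (fun s => (c s)%:~R); first by exists 1%g; rewrite c1.
  move=> a; apply: rep_separates => rho rhoA.
  by rewrite (alg_morph_multilinear rhoA) (c0 K (fun i => rho (a i))).
have [rho [rhoA onto]] := exists_rep_onto.
apply: (leq_multilinear_identity l12_gt0 cs0) => B.
have [a ha] := fin_all_exists (fun i => onto (B i)).
rewrite -[RHS](alg_morph0 rhoA) -(cid a) (alg_morph_multilinear rhoA).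
by apply: eq_bigr => s _; congr (_ *: _); apply: eq_bigr => i _; rewrite ha.
Qed.
End PIdegreeTensor.

Theorem theorem3p1 (K : closedFieldType) (q1 q2 lam : K) (l1 l2 : nat)
    (q1_neq0 : q1 != 0) (q1_neq1 : q1 != 1)
    (q2_neq0 : q2 != 0) (q2_neq1 : q2 != 1) (lam_neq0 : lam != 0)
    (q1_prim : l1.-primitive_root q1) (q2_prim : l2.-primitive_root q2)
    (lam_root : lam ^+ l1 = 1) :
  PI_degree (qweyl2 q1 q2 lam q1_neq1) (l1 * l2)%N.
Proof.
have q1l := prim_expr_order q1_prim; have q2l := prim_expr_order q2_prim.
have l12_gt0 : (0 < l1 * l2)%N.
  by rewrite muln_gt0 (prim_order_gt0 q1_prim) (prim_order_gt0 q2_prim).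
apply: (PI_degree_tensor q1_neq0 q1_neq1 q2_neq0 q2_neq1 lam_neq0 q1_prim q2_prim
  (pbw_span q1_neq0 lam_neq0)) => a g b h a0 g0 b0 h0.
have [rho [rhoA rho_gen]] := weyl_rep_exists q1_neq1 l12_gt0
  (repX1_repX2 l2 q1l lam_root a b) (repX1_repY2 q1 q2 l2 lam_root a g b h)
  (repY1_repY2 q1 q2 l2 lam_neq0 lam_root a g b h)
  (repY1_repX2 l2 q1_neq0 lam_neq0 q1l lam_root a g b)
  (repX1_repY1 l2 q1_neq1 q1l g a0)
  (repX2_repY2 l1 q1_neq1 q2_neq1 lam_neq0 q2l g h a0 b0).
by exists rho.
Qed.
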